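(* Let $n,m\ge1$, and let $F=(f,h):D_{1,1}\rightarrow D_{n,m}$ be a holomorphic mapping which is holomorphic at $p=(0,1)\in\partial D_{1,1}$ (i.e. extends holomorphically to a neighborhood of $p$) with $F(p)=q$, where $q=(0,\ldots,0,1,0,\ldots,0)\in\partial D_{n,m}$ is the point with $z=(0,\dots,0)\in\mathbb{C}^n$ and $w=(1,0,\dots,0)\in\mathbb{C}^m$. Here $f=(f_1,\dots,f_n)$ and $h=(h_1,\dots,h_m)$. Then there exists $\lambda\in\mathbb{R}$ such that the following hold. (i) $$\overline{J_F(p)}^{T}q^{T}=\lambda p^T\quad\text{and}\quad \lambda\geq\frac{|1-\overline{h_1(0)}|^2}{1-|h_1(0)|^2}>0.$$ (ii) $J_F(p)$ can be regarded as a linear operator from $T_p^{1,0}(\partial D_{1,1})$ to $T_{F(p)}^{1,0}(\partial D_{n,m})$, and moreover $$\|J_F(p)\|_{op}\leq\sqrt{\lambda},$$ where $\|\cdot\|_{op}$ is the usual operator norm of this operator (with respect to Euclidean norms).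
   Context: For $n,m\geq 1$ the Fock-Bargmann-Hartogs domain is $D_{n,m}=\{(z,w)\in\mathbb{C}^n\times\mathbb{C}^m:\ \|w\|^2<e^{-\|z\|^2}\}$, with $\|\cdot\|$ the Euclidean norm. Points are written as row vectors; $T$ denotes transpose. $J_F(p)$ is the complex Jacobian matrix of $F$ at $p$, of size $(n+m)\times 2$, with entries $\partial F_i/\partial x_j(p)$, where $(x_1,x_2)=(z,w)$ are the coordinates of $\mathbb{C}^2$; it acts on a row vector $\alpha$ by $\alpha^T\mapsto J_F(p)\alpha^T$. $h_1(0)$ is the value of $h_1$ at the origin of $\mathbb{C}^2$. The complex tangent space to $\partial D_{n,m}$ at a boundary point $(z,w)$ is $$T^{1,0}_{(z,w)}(\partial D_{n,m})=\Big\{(\alpha,\beta)\in\mathbb{C}^{n}\times\mathbb{C}^m:\ \sum_{k=1}^m\overline{w_k}\beta_k+\sum_{j=1}^n e^{-\|z\|^2}\overline{z_j}\alpha_j=0\Big\}.$$ In particular $T_p^{1,0}(\partial D_{1,1})=\{(\alpha,\beta)\in\mathbb{C}^2:\beta=0\}$ and $T_q^{1,0}(\partial D_{n,m})=\{(\alpha,\beta)\in\mathbb{C}^{n}\times\mathbb{C}^{m}:\beta_1=0\}$. The vectors $p^T$ and $q^T$ are the normal vectors to $\partial D_{1,1}$ at $p$ and to $\partial D_{n,m}$ at $q$, respectively. *)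

(* Defs.v *)
From HB Require Import structures.
From mathcomp Require Import all_boot all_order all_algebra.
From mathcomp Require Import complex.
From mathcomp Require Import all_classical all_reals all_analysis.

Set Implicit Arguments.
Unset Strict Implicit.
Unset Printing Implicit Defensive.

Import Order.TTheory GRing.Theory Num.Theory.
Import numFieldNormedType.Exports.

Local Open Scope classical_set_scope.
Local Open Scope ring_scope.

(* The name keeps R[i] behind its numClosedFieldType structure: the topology
   and the normed space structure of the modules 'rV_k are inferred from that
   structure, not from the bare type R[i]. *)
Definition Cplx (R : realType) : numClosedFieldType :=
  Num.ClosedField.clone R[i] _.

(* Real-valued, whereas the library norm `|z| of z : R[i] lies in R[i]. *)
Definition cabs (R : realType) (z : Cplx R) : R := ComplexField.Normc.normc z.

(* Euclidean norm; the library norm on 'rV_k is the sup norm. *)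
Definition enorm (R : realType) (k : nat) (v : 'rV[Cplx R]_k) : R :=
  Num.sqrt (\sum_(i < k) cabs (v 0 i) ^+ 2).

(* Fock-Bargmann-Hartogs domain; (z, w) in C^n x C^m is the row vector
   row_mx z w of length n + m. *)
Definition FBH (R : realType) (n m : nat) : set 'rV[Cplx R]_(n + m) :=
  [set x | enorm (rsubmx x) ^+ 2 < expR (- enorm (lsubmx x) ^+ 2)].
Arguments FBH : clear implicits.

(* z = 0, w = (1, 0, ..., 0) *)
Definition bpoint (R : realType) (n m : nat) : 'rV[Cplx R]_(n + m) :=
  row_mx 0 (\row_(j < m) ((j : nat) == 0)%:R).
Arguments bpoint : clear implicits.

(* T^{1,0}_x of the boundary of FBH R n m, for x = (z, w) on this boundary *)
Definition ctangent (R : realType) (n m : nat) (x : 'rV[Cplx R]_(n + m)) :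
    set 'rV[Cplx R]_(n + m) :=
  [set v | let z := lsubmx x in let w := rsubmx x in
           let a := lsubmx v in let b := rsubmx v in
           \sum_(k < m) (w 0 k)^* * b 0 k
           + \sum_(j < n) (expR (- enorm z ^+ 2))%:C%C * (z 0 j)^* * a 0 j = 0].

(* Differentiability over the scalar field Cplx R is complex
   differentiability. *)
Definition holomorphic_at (R : realType) (k l : nat)
    (F : 'rV[Cplx R]_k -> 'rV[Cplx R]_l) (x : 'rV[Cplx R]_k) : Prop :=
  \forall y \near x, differentiable F y.

(* The library's 'J F x is k x l and acts on row vectors from the right, so
   that the usual Jacobian matrix is its transpose, see cjacE. *)
Definition cjac (R : realType) (k l : nat)
    (F : 'rV[Cplx R]_k -> 'rV[Cplx R]_l) (x : 'rV[Cplx R]_k) :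
    'M[Cplx R]_(l, k) := ('J F x)^T.

Lemma jacobianE (K : numFieldType) (k l : nat)
    (F : 'rV[K]_k -> 'rV[K]_l) (x : 'rV[K]_k) i j :
  differentiable F x ->
  ('J F x) i j = 'D_(delta_mx 0 i) (fun y => F y 0 j : K^o) x.
Proof.
move=> dF.
have dc := @differentiable_coord K _ _ (F x) 0 j.
have dg : differentiable (fun y => F y 0 j : K^o) x.
  exact: (@differentiable_comp _ _ _ _ F (fun M => M 0 j : K^o)).
have -> := deriveE (delta_mx 0 i) dg.
have -> := @diff_comp _ _ _ _ F (fun M : 'rV[K]_l => M 0 j : K^o) x dF dc.
rewrite /= /jacobian /lin1_mx mxE.
have @f : {linear 'rV[K]_l -> K^o}.
  by exists (fun N : 'rV[K]_l => N 0 j : K^o); do 2![eexists]; do ?[constructor];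
     rewrite ?mxE// => ? *; rewrite ?mxE//; move=> ?; rewrite !mxE.
by rewrite (_ : (fun _ => _) = f) // diff_lin //; exact/coord_continuous.
Qed.

Lemma cjacE (R : realType) (k l : nat)
    (F : 'rV[Cplx R]_k -> 'rV[Cplx R]_l) (x : 'rV[Cplx R]_k) i j :
  differentiable F x ->
  cjac F x i j = 'D_(delta_mx 0 j) (fun y => F y 0 i : (Cplx R)^o) x.
Proof.
by move=> dF; rewrite mxE; exact: jacobianE.
Qed.

(* Operator norm of A on the subspace T, with respect to Euclidean norms *)
Definition opnorm (R : realType) (k l : nat) (T : set 'rV[Cplx R]_k)
    (A : 'M[Cplx R]_(l, k)) : \bar R :=
  ereal_sup [set (enorm (A *m a^T)^T)%:E | a in [set a | T a /\ enorm a <= 1]].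

(* Main.v *)
Require Import Defs.
From HB Require Import structures.
From mathcomp Require Import all_boot all_order all_algebra.
From mathcomp Require Import complex.
From mathcomp Require Import all_classical all_reals all_analysis.
From mathcomp Require Import ring lra.

Set Implicit Arguments.
Unset Strict Implicit.
Unset Printing Implicit Defensive.

Import Order.TTheory GRing.Theory Num.Theory.
Import numFieldNormedType.Exports.

Local Open Scope classical_set_scope.
Local Open Scope ring_scope.

(** Write p = (0, 1), let h_1 be the first coordinate of the w-part of F, and
let lambda be the derivative of h_1 at p along w.  The theorem collects three
facts about the first derivatives of F at p.

First order.  If Re b < 0 then p + t (a, b) lies in D_{1,1} for small t > 0,
whatever a is, so the real part of the differential of h_1 at p is nonpositive
on (a, b).  As a is free, the z-derivative of h_1 at p vanishes; letting Im b
vary, the w-derivative is real and nonnegative ([normal_derivative]).  This is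
the identity for the conjugate transpose of the Jacobian matrix, and it says
that complex tangent vectors go to complex tangent vectors.

Lower bound on lambda.  The function w |-> h_1(0, w) maps the unit disk to
itself.  Its Schwarz-Pick estimate at the origin, written at w = 1 - t and
divided by t, tends to the stated inequality as t -> 0 ([boundary_schwarz]); its
left-hand side is positive because |h_1(0)| < 1.

Operator norm.  Let A be the sum of |dF_j/dz(p)|^2 over the coordinates F_j
other than h_1, and S the sum of the |F_j|^2.  The inequality that defines
D_{n,m} gives |h_1|^2 + S <= 1 + S^2, hence 2 Re h_1 <= 2 - A r^2 + o(r^2) on
the circle |z| = r at height w = 1 - kappa r^2; this circle bounds a disk in
D_{1,1} if kappa > 1/2 and r is small.  A term of order z^2 in h_1 has the same size
as these quantities on the circle, but by the mean value property the upper
bound survives at z = 0, where Re h_1 = 1 - lambda kappa r^2 + o(r^2).  So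
A <= 2 kappa lambda, and kappa tends to 1/2 ([tangential_derivative_bound]).

Holomorphic functions are here complex differentiable functions whose
derivative is not known to be continuous, so the mean value property and the
maximum principle rest on Goursat's theorem.  In the coordinates
z = exp (s + i t) the real and imaginary parts of g satisfy the Cauchy-Riemann
equations, quadrisection of rectangles ([additive_rect_eq0],
[cauchy_riemann_flux]) shows that the integral of Re g over 0 <= t <= 2 pi does
not depend on s, and s -> -oo brings in the value at the centre
([punctured_mean_value_le]).  Only continuity of g is used at the centre: this
is what lets the maximum principle ([punctured_max_principle]) be applied to
the quotient of Schwarz's lemma, k(w) / w, without discussing whether it is
differentiable at 0. *)

(** * Goursat's theorem on rectangles *)

Definition half_of {R : realType} (I J : R * R) : Prop :=
  let mid := (I.1 + I.2) / 2 in J = (I.1, mid) \/ J = (mid, I.2).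

Lemma nested_halves (R : realType) (I : nat -> R * R) :
  (I 0%N).1 <= (I 0%N).2 -> (forall k, half_of (I k) (I k.+1)) ->
  (forall k, (I k).2 - (I k).1 = ((I 0%N).2 - (I 0%N).1) / 2 ^+ k) /\
  exists x, forall k, (I 0%N).1 <= (I k).1 <= x /\ x <= (I k).2 <= (I 0%N).2.
Proof.
move=> I0 hI.
have len k : (I k).2 - (I k).1 = ((I 0%N).2 - (I 0%N).1) / 2 ^+ k.
  elim: k => [|k IH]; first by rewrite expr0 divr1.
  rewrite exprS invfM mulrCA -IH.
  by case: (hI k) => ->/=; field.
split=> //.
have le12 k : (I k).1 <= (I k).2.
  by rewrite -subr_ge0 len divr_ge0 ?exprn_ge0// subr_ge0.
have step k : (I k).1 <= (I k.+1).1 /\ (I k.+1).2 <= (I k).2.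
  by have := le12 k; case: (hI k) => -> /=; lra.
have mono k j : (I k).1 <= (I (k + j)%N).1 /\ (I (k + j)%N).2 <= (I k).2.
  elim: j => [|j IH]; first by rewrite addn0.
  by rewrite addnS; have := step (k + j)%N; lra.
have cross k j : (I k).1 <= (I j).2.
  case: (leqP k j) => [/subnKC <-|/ltnW/subnKC <-].
    by have := mono k (j - k)%N; have := le12 (k + (j - k))%N; lra.
  by have := mono j (k - j)%N; have := le12 (j + (k - j))%N; lra.
pose A := range (fun k => (I k).1).
have A0 : A !=set0 by exists (I 0%N).1, 0%N.
have ubA k : ubound A (I k).2 by move=> _ [j _ <-]; exact: cross.
exists (sup A) => k.
have := mono 0%N k; rewrite add0n => -[-> ->]; rewrite andbT /=; split.
  by apply: ub_le_sup; [exists (I 0%N).2; exact: ubA|exists k].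
by apply: ge_sup => //; exact: ubA.
Qed.

(** Goursat's argument for a general additive function of rectangles.  If
[E I0 J0] is nonzero, some quarter carries at least a quarter of it, and so on;
after k steps the value is still of order 4^-k, while near the common point of
the nested rectangles it is at most e times the square of the half-perimeter,
which is also of order 4^-k.  As e is arbitrary, this is a contradiction.
[E I J] is the value on the rectangle with sides I and J. *)
Lemma additive_rect_eq0 (R : realType) (E : R * R -> R * R -> R) (I0 J0 : R * R) :
  (forall x y z J, E (x, z) J = E (x, y) J + E (y, z) J) ->
  (forall I x y z, E I (x, z) = E I (x, y) + E I (y, z)) ->
  I0.1 <= I0.2 -> J0.1 <= J0.2 ->
  (forall x y, I0.1 <= x <= I0.2 -> J0.1 <= y <= J0.2 ->
    forall e, 0 < e -> exists2 del, 0 < del & forall I J : R * R,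
      I0.1 <= I.1 <= x -> x <= I.2 <= I0.2 ->
      J0.1 <= J.1 <= y -> y <= J.2 <= J0.2 ->
      I.2 - I.1 < del -> J.2 - J.1 < del ->
      `|E I J| <= e * ((I.2 - I.1) + (J.2 - J.1)) ^+ 2) ->
  E I0 J0 = 0.
Proof.
move=> E1 E2 hI0 hJ0 loc.
have step (IJ : (R * R) * (R * R)) : exists IJ' : (R * R) * (R * R),
    [/\ half_of IJ.1 IJ'.1, half_of IJ.2 IJ'.2
      & `|E IJ.1 IJ.2| <= 4 * `|E IJ'.1 IJ'.2| ].
  case: IJ => -[x0 x1] [y0 y1] /=.
  set xm := (x0 + x1) / 2; set ym := (y0 + y1) / 2.
  have : E (x0, x1) (y0, y1) = E (x0, xm) (y0, ym) + E (x0, xm) (ym, y1)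
                            + (E (xm, x1) (y0, ym) + E (xm, x1) (ym, y1)).
    by rewrite (E1 _ xm) !(E2 _ y0 ym y1).
  have [le1|gt1] := leP (`|E (x0, x1) (y0, y1)|) (4 * `|E (x0, xm) (y0, ym)|).
    by move=> _; exists ((x0, xm), (y0, ym)); split=> //; left.
  have [le2|gt2] := leP (`|E (x0, x1) (y0, y1)|) (4 * `|E (x0, xm) (ym, y1)|).
    by move=> _; exists ((x0, xm), (ym, y1)); split=> //; [left|right].
  have [le3|gt3] := leP (`|E (x0, x1) (y0, y1)|) (4 * `|E (xm, x1) (y0, ym)|).
    by move=> _; exists ((xm, x1), (y0, ym)); split=> //; [right|left].
  have [le4|gt4] := leP (`|E (x0, x1) (y0, y1)|) (4 * `|E (xm, x1) (ym, y1)|).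
    by move=> _; exists ((xm, x1), (ym, y1)); split=> //; right.
  move=> eqE.
  have : `|E (x0, x1) (y0, y1)| <= `|E (x0, xm) (y0, ym)| + `|E (x0, xm) (ym, y1)|
                 + (`|E (xm, x1) (y0, ym)| + `|E (xm, x1) (ym, y1)|).
    rewrite eqE (le_trans (ler_normD _ _))// lerD//; exact: ler_normD.
  lra.
have [f hf] := choice step.
pose Q := fix Q k := if k is k'.+1 then f (Q k') else (I0, J0).
have [lenI [x hx]] := @nested_halves R (fun k => (Q k).1) hI0
  (fun k => let: And3 h _ _ := hf (Q k) in h).
have [lenJ [y hy]] := @nested_halves R (fun k => (Q k).2) hJ0
  (fun k => let: And3 _ h _ := hf (Q k) in h).
have big k : `|E I0 J0| <= 4 ^+ k * `|E (Q k).1 (Q k).2|.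
  elim: k => [|k IH]; first by rewrite mul1r.
  rewrite (le_trans IH)// exprSr -mulrA ler_wpM2l ?exprn_ge0//.
  by case: (hf (Q k)).
apply/eqP; rewrite -normr_eq0 eq_le normr_ge0 andbT leNgt; apply/negP => Epos.
move: lenI lenJ hx hy => /=.
set S := I0.2 - I0.1; set T := J0.2 - J0.1 => lenI lenJ hx hy.
have S0 : 0 <= S by rewrite subr_ge0.
have T0 : 0 <= T by rewrite subr_ge0.
have ST1 : 0 < (S + T) ^+ 2 + 1 by rewrite ltr_wpDl ?sqr_ge0.
have e0 : 0 < `|E I0 J0| / ((S + T) ^+ 2 + 1) by rewrite divr_gt0.
have xI : I0.1 <= x <= I0.2 by have := hx 0%N => /= -[/andP[_ ->] /andP[->]].
have yJ : J0.1 <= y <= J0.2 by have := hy 0%N => /= -[/andP[_ ->] /andP[->]].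
have [del del0 hdel] := loc _ _ xI yJ _ e0.
have [k hk] : exists k, S + T < del * 2 ^+ k.
  have [k] : exists k : nat, (S + T) / del < k%:R.
    exists (Num.bound ((S + T) / del)); apply: Num.Theory.archi_boundP.
    by apply: divr_ge0; [exact: addr_ge0|exact: ltW].
  rewrite ltr_pdivrMr// mulrC => ltk; exists k.
  rewrite (lt_trans ltk)// ltr_pM2l// -natrX ltr_nat; exact: ltn_expl.
have p2 : 0 < (2 : R) ^+ k by rewrite exprn_gt0.
have lenI' := lenI k; have lenJ' := lenJ k.
have := hdel (Q k).1 (Q k).2.
have [-> ->] := hx k; have [-> ->] := hy k.
rewrite lenI' lenJ' !ltr_pdivrMr// => /(_ isT isT isT isT).
move=> /(_ ltac:(lra) ltac:(lra)).
rewrite -mulrDl exprMn exprVn -exprM mulnC exprM (_ : 2 ^+ 2 = 4); last by ring.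
have p4 : 0 < (4 : R) ^+ k by rewrite exprn_gt0.
rewrite mulrA ler_pdivlMr// => le1.
have := le_trans (big k) (_ : _ <= `|E I0 J0| / ((S + T) ^+ 2 + 1) * (S + T) ^+ 2).
rewrite mulrC => /(_ le1).
rewrite mulrAC ler_pdivlMr// ler_pM2l//; lra.
Qed.

Lemma mean_value (R : realType) (f df : R -> R) (a b : R) : a <= b ->
  (forall x, a <= x <= b -> is_derive x 1 f (df x)) ->
  exists2 c, a <= c <= b & f b - f a = df c * (b - a).
Proof.
move=> ab fd.
have [||c cab ->] := @MVT_segment R f df a b ab.
- by move=> x; rewrite in_itv/= => /andP[/ltW ax /ltW xb]; apply: fd; rewrite ax.
- apply: derivable_within_continuous => x; rewrite in_itv/= => xab.
  by have [] := fd x xab.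
- by exists c.
Qed.

(** Goursat's theorem for u + i v on a rectangle, imaginary part: the integral of
v dx + u dy over the boundary vanishes.  Integrals along vertical and horizontal
lines are increments of the primitives [U x] and [V^~ y], which makes the
boundary integral additive by mere algebra.  The Cauchy-Riemann equations hold
pointwise: (al, be) are the real and imaginary parts of the derivative at
(x, y).  By the mean value theorem the flux through a small rectangle of sides
dx, dy is (u(x1, eta) - u(x0, eta)) dy - (v(xi, y1) - v(xi, y0)) dx, where both
products are al dx dy up to a small multiple of (dx + dy)^2. *)
Lemma cauchy_riemann_flux (R : realType) (u v U V : R -> R -> R) (a b c d : R) :
  a <= b -> c <= d ->
  (forall x y, a <= x <= b -> c <= y <= d -> is_derive y 1 (U x) (u x y)) ->
  (forall x y, a <= x <= b -> c <= y <= d -> is_derive x 1 (V^~ y) (v x y)) ->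
  (forall x y, a <= x <= b -> c <= y <= d -> exists al be : R,
    forall e, 0 < e -> exists2 del, 0 < del & forall x' y',
      a <= x' <= b -> c <= y' <= d -> `|x' - x| < del -> `|y' - y| < del ->
      `|u x' y' - u x y - (al * (x' - x) - be * (y' - y))|
        <= e * (`|x' - x| + `|y' - y|) /\
      `|v x' y' - v x y - (be * (x' - x) + al * (y' - y))|
        <= e * (`|x' - x| + `|y' - y|)) ->
  (U b d - U b c) - (U a d - U a c) = (V b d - V a d) - (V b c - V a c).
Proof.
move=> ab cd dU dV cr.
pose E (I J : R * R) := (U I.2 J.2 - U I.2 J.1) - (U I.1 J.2 - U I.1 J.1)
  - ((V I.2 J.2 - V I.1 J.2) - (V I.2 J.1 - V I.1 J.1)).
apply/eqP; rewrite -subr_eq0; apply/eqP.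
apply: (@additive_rect_eq0 R E (a, b) (c, d)) => //=.
- by move=> *; rewrite /E/=; ring.
- by move=> *; rewrite /E/=; ring.
move=> x y xab ycd e e0.
have [al [be Hcr]] := cr x y xab ycd.
have [del del0 H] := Hcr _ (divr_gt0 e0 (ltr0n R 2)).
exists del => // -[x0 x1] [y0 y1] /= x0x xx1 y0y yy1 lx ly.
have x01 : x0 <= x1 by lra.
have y01 : y0 <= y1 by lra.
have [eta etaP Ueq] : exists2 eta, y0 <= eta <= y1 &
    (U x1 y1 - U x0 y1) - (U x1 y0 - U x0 y0) = (u x1 eta - u x0 eta) * (y1 - y0).
  apply: (@mean_value R (fun y => U x1 y - U x0 y) (fun y => u x1 y - u x0 y)) => //.
  move=> t t01.
  have h1 : is_derive t 1 (U x1) (u x1 t) by apply: dU; lra.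
  have h0 : is_derive t 1 (U x0) (u x0 t) by apply: dU; lra.
  exact: is_deriveB.
have [xi xiP Veq] : exists2 xi, x0 <= xi <= x1 &
    (V x1 y1 - V x1 y0) - (V x0 y1 - V x0 y0) = (v xi y1 - v xi y0) * (x1 - x0).
  apply: (@mean_value R (fun x => V x y1 - V x y0) (fun x => v x y1 - v x y0)) => //.
  move=> t t01.
  have h1 : is_derive t 1 (V^~ y1) (v t y1) by apply: dV; lra.
  have h0 : is_derive t 1 (V^~ y0) (v t y0) by apply: dV; lra.
  exact: is_deriveB.
have near x' y' : x0 <= x' <= x1 -> y0 <= y' <= y1 ->
   [/\ `|u x' y' - u x y - (al * (x' - x) - be * (y' - y))|
        <= e / 2 * ((x1 - x0) + (y1 - y0)) &
      `|v x' y' - v x y - (be * (x' - x) + al * (y' - y))|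
        <= e / 2 * ((x1 - x0) + (y1 - y0))].
  move=> x'P y'P.
  have dx : `|x' - x| <= x1 - x0 by rewrite ler_norml; lra.
  have dy : `|y' - y| <= y1 - y0 by rewrite ler_norml; lra.
  have [||||h1 h2] := H x' y'; try lra.
  by split; [apply: (le_trans h1)|apply: (le_trans h2)];
    rewrite ler_wpM2l ?divr_ge0 ?(ltW e0)//; exact: lerD.
have [A1 _] := near x1 eta ltac:(lra) etaP.
have [A2 _] := near x0 eta ltac:(lra) etaP.
have [_ A3] := near xi y1 xiP ltac:(lra).
have [_ A4] := near xi y0 xiP ltac:(lra).
set S := (x1 - x0) + (y1 - y0) in A1 A2 A3 A4 *.
have Bu : `|u x1 eta - u x0 eta - al * (x1 - x0)| <= e * S.
  by move: A1 A2; rewrite !ler_norml; lra.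
have Bv : `|v xi y1 - v xi y0 - al * (y1 - y0)| <= e * S.
  by move: A3 A4; rewrite !ler_norml; lra.
have -> : E (x0, x1) (y0, y1) = (u x1 eta - u x0 eta - al * (x1 - x0)) * (y1 - y0)
     - (v xi y1 - v xi y0 - al * (y1 - y0)) * (x1 - x0).
  rewrite [RHS](_ : _ = (u x1 eta - u x0 eta) * (y1 - y0)
     - (v xi y1 - v xi y0) * (x1 - x0)); last by ring.
  by rewrite -Ueq -Veq /E/=; ring.
rewrite (le_trans (ler_normB _ _))// !normrM.
rewrite (ger0_norm (_ : 0 <= y1 - y0)) ?subr_ge0//.
rewrite (ger0_norm (_ : 0 <= x1 - x0)) ?subr_ge0//.
have -> : e * S ^+ 2 = e * S * (y1 - y0) + e * S * (x1 - x0) by rewrite /S; ring.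
by apply: lerD; apply: ler_wpM2r => //; rewrite subr_ge0.
Qed.

Lemma primitive_exists (R : realType) (f : R -> R) (a b : R) :
  (forall x, a <= x <= b -> {for x, continuous f}) ->
  exists F : R -> R, forall x, a < x < b -> is_derive x 1 F (f x).
Proof.
move=> cf.
exists (parameterized_integral lebesgue_measure a ^~ f) => x /andP[ax xb].
have [||d e] := @continuous_FTC1_closed R f a x b xb _ ax.
- apply: continuous_compact_integrable; first exact: segment_compact.
  apply: continuous_in_subspaceT => t; rewrite inE/= in_itv/=; exact: cf.
- by apply: cf; rewrite !ltW.
by apply: DeriveDef => //; rewrite -derive1E -e.
Qed.

(** * The modulus and complex differentiability *)

Lemma cabs_ge0 (R : realType) (z : Cplx R) : 0 <= cabs z.
Proof. by case: z => a b; exact: sqrtr_ge0. Qed.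

Lemma cabs0 (R : realType) : cabs (0 : Cplx R) = 0.
Proof. exact: ComplexField.Normc.normc0. Qed.

Lemma cabs1 (R : realType) : cabs (1 : Cplx R) = 1.
Proof. exact: ComplexField.Normc.normc1. Qed.

Lemma cabsM (R : realType) (x y : Cplx R) : cabs (x * y) = cabs x * cabs y.
Proof. exact: ComplexField.Normc.normcM. Qed.

Lemma cabsV (R : realType) (x : Cplx R) : cabs x^-1 = (cabs x)^-1.
Proof. exact: ComplexField.Normc.normcV. Qed.

Lemma cabsN (R : realType) (x : Cplx R) : cabs (- x) = cabs x.
Proof. exact: normcN. Qed.

Lemma cabsD (R : realType) (x y : Cplx R) : cabs (x + y) <= cabs x + cabs y.
Proof. exact: le_normcD. Qed.

Lemma cabs_eq0 (R : realType) (x : Cplx R) : (cabs x == 0) = (x == 0).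
Proof.
by apply/eqP/eqP => [/ComplexField.Normc.eq0_normc//|->]; rewrite cabs0.
Qed.

Lemma cabs_gt0 (R : realType) (x : Cplx R) : (0 < cabs x) = (x != 0).
Proof. by rewrite lt_neqAle cabs_ge0 andbT eq_sym cabs_eq0. Qed.

Lemma cabs_normE (R : realType) (x : Cplx R) : `|x| = (cabs x)%:C%C.
Proof. by []. Qed.

Lemma cabs_sqrE (R : realType) (z : Cplx R) :
  cabs z ^+ 2 = complex.Re z ^+ 2 + complex.Im z ^+ 2.
Proof. by case: z => a b /=; rewrite sqr_sqrtr// addr_ge0 ?sqr_ge0. Qed.

Lemma cabs_real (R : realType) (x : R) : cabs (x%:C%C : Cplx R) = `|x|.
Proof. by rewrite /cabs/= expr0n addr0 sqrtr_sqr. Qed.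

Lemma cabsJ (R : realType) (z : Cplx R) : cabs z^* = cabs z.
Proof.
by apply: (@complexI R); rewrite -!cabs_normE norm_conjC.
Qed.

Lemma Re_le_cabs (R : realType) (z : Cplx R) : `|complex.Re z| <= cabs z.
Proof.
by rewrite -ler_sqr ?nnegrE ?cabs_ge0// real_normK ?num_real// cabs_sqrE lerDl sqr_ge0.
Qed.

Lemma Im_le_cabs (R : realType) (z : Cplx R) : `|complex.Im z| <= cabs z.
Proof.
by rewrite -ler_sqr ?nnegrE ?cabs_ge0// real_normK ?num_real// cabs_sqrE lerDr sqr_ge0.
Qed.

Lemma cabs_le (R : realType) (z : Cplx R) :
  cabs z <= `|complex.Re z| + `|complex.Im z|.
Proof.
rewrite -ler_sqr ?nnegrE ?cabs_ge0 ?addr_ge0// cabs_sqrE sqrrD.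
rewrite !real_normK ?num_real// -addrA (addrC (_ *+ 2)) addrA lerDl.
by rewrite mulrn_wge0// mulr_ge0.
Qed.

Lemma cReD (R : realType) (x y : Cplx R) :
  complex.Re (x + y) = complex.Re x + complex.Re y.
Proof. by case: x; case: y. Qed.

Lemma cImD (R : realType) (x y : Cplx R) :
  complex.Im (x + y) = complex.Im x + complex.Im y.
Proof. by case: x; case: y. Qed.

Lemma cReN (R : realType) (x : Cplx R) : complex.Re (- x) = - complex.Re x.
Proof. by case: x. Qed.

Lemma cImN (R : realType) (x : Cplx R) : complex.Im (- x) = - complex.Im x.
Proof. by case: x. Qed.

Lemma cReM (R : realType) (x y : Cplx R) :
  complex.Re (x * y) = complex.Re x * complex.Re y - complex.Im x * complex.Im y.
Proof. by case: x; case: y. Qed.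

Lemma cImM (R : realType) (x y : Cplx R) :
  complex.Im (x * y) = complex.Re x * complex.Im y + complex.Im x * complex.Re y.
Proof. by case: x; case: y. Qed.

(** Norms over [Cplx R] take values in [Cplx R]; the next lemmas restate
neighbourhoods, differentiability and continuity with real radii and errors. *)
Lemma near_normP (R : realType) (V : normedModType (Cplx R)) (x : V) (P : V -> Prop) :
  (\forall y \near x, P y) ->
  exists2 d : R, 0 < d & forall h : V, `|h| < d%:C%C -> P (x + h).
Proof.
move=> /nbhs_normP[e /=]; rewrite ltcE => /andP[/eqP e0 e1] H.
exists (complex.Re e) => // h hd; apply: H => /=.
rewrite opprD addrA subrr sub0r normrN (lt_le_trans hd)//.
by rewrite lecE/= e0 eqxx lexx.
Qed.

Lemma differentiable_expansion (R : realType) (V W : normedModType (Cplx R))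
    (f : V -> W) (x : V) : differentiable f x ->
  forall e : R, 0 < e -> exists2 d : R, 0 < d & forall h : V, `|h| < d%:C%C ->
    `|f (x + h) - f x - 'd f x h| <= e%:C%C * `|h|.
Proof.
move=> df e e0.
have [_ /eqaddoP dfx] := (diff_locallyP x f).1 df.
have : 0 < (e%:C%C : Cplx R) by rewrite ltcE/= eqxx.
move=> /dfx /near_normP [d d0 H]; exists d => // h /H /=.
by rewrite add0r /= !fctE /= opprD addrA [h + x]addrC.
Qed.

Lemma cdifferentiable_expansion (R : realType) (g : Cplx R -> Cplx R) z :
  differentiable g z -> exists c : Cplx R,
  forall e : R, 0 < e -> exists2 d : R, 0 < d & forall h : Cplx R, cabs h < d ->
    cabs (g (z + h) - g z - c * h) <= e * cabs h.
Proof.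
move=> dg; exists ('d g z 1) => e /(differentiable_expansion dg)[d d0 H].
exists d => // h hd; have := H h.
rewrite !cabs_normE ltcR => /(_ hd); rewrite -rmorphM/= lecR.
suff -> : 'd g z h = 'd g z 1 * h by [].
by rewrite -{1}[h]mulr1 linearZ mulrC.
Qed.

Lemma ccontinuous_bound (R : realType) (g : Cplx R -> Cplx R) z :
  {for z, continuous g} ->
  forall e : R, 0 < e -> exists2 d : R, 0 < d & forall h : Cplx R, cabs h < d ->
    cabs (g (z + h) - g z) < e.
Proof.
move=> /cvgrPdist_lt cg e e0.
have : 0 < (e%:C%C : Cplx R) by rewrite ltcE/= eqxx.
move=> /cg /near_normP[d d0 H]; exists d => // h hd.
by have := H h; rewrite distrC !cabs_normE !ltcR; exact.
Qed.

Lemma differentiable_mull (R : realType) (c z : Cplx R) :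
  differentiable (fun w => c * w) z.
Proof. by apply: differentiableM. Qed.

Lemma differentiable_addl (R : realType) (c z : Cplx R) :
  differentiable (fun w => c + w) z.
Proof. by apply: differentiableD. Qed.

Lemma differentiable_comp_addl (R : realType) (g : Cplx R -> Cplx R) (c z : Cplx R) :
  differentiable g (c + z) -> differentiable (fun w => g (c + w)) z.
Proof.
move=> dg; apply: (differentiable_comp (@differentiable_addl R c z)).
exact dg.
Qed.

Lemma ccontinuous_intro (R : realType) (g : Cplx R -> Cplx R) z :
  (forall e : R, 0 < e -> exists2 d : R, 0 < d & forall h : Cplx R, cabs h < d ->
    cabs (g (z + h) - g z) <= e) ->
  {for z, continuous g}.
Proof.
move=> H; apply/(@cvgrPdist_le _ _ _ _ (nbhs_filter z)) => e; rewrite ltcE /=.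
move=> /andP[/eqP e1 e0]; have [d d0 Hd] := H _ e0.
apply/nbhs_normP; exists d%:C%C; first by rewrite /= ltcE/= eqxx.
move=> w /=; rewrite !cabs_normE ltcR lecE/= e1 eqxx/= => hd.
have := Hd (w - z); rewrite subrKC -cabsN opprB => /(_ hd).
by rewrite -cabsN opprB.
Qed.

(** * Mean value property and maximum principle *)

Lemma real_expansion (R : realType) (f : R -> R) (x df : R) :
  is_derive x 1 f df -> forall e : R, 0 < e -> exists2 d : R, 0 < d &
  forall h : R, `|h| < d -> `|f (x + h) - f x - df * h| <= e * `|h|.
Proof.
move=> dfx e e0.
have /derivable1_diffP dif := @ex_derive _ _ _ _ _ _ _ dfx.
have [_ /eqaddoP] := (diff_locallyP x f).1 dif.
move=> /(_ e e0) /nbhs_normP[d /= d0 H]; exists d => // h hd.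
have /= := H h; rewrite sub0r normrN => /(_ hd).
rewrite !fctE /= opprD addrA [h + x]addrC.
suff -> : 'd f x h = df * h by [].
by rewrite diff1E//= derive1E (@derive_val _ _ _ _ _ _ _ dfx) mulrC.
Qed.

(** exp (s + i t) *)
Definition cexp (R : realType) (s t : R) : Cplx R :=
  ((expR s * cos t) +i* (expR s * sin t))%C.

Lemma cexpD (R : realType) (s s' t t' : R) :
  cexp (s + s') (t + t') = cexp s t * cexp s' t'.
Proof.
rewrite /cexp expRD cosD sinD.
by apply/eqP; rewrite eq_complex/=; apply/andP; split; apply/eqP; ring.
Qed.

Lemma cabs_cexp (R : realType) (s t : R) : cabs (cexp s t) = expR s.
Proof.
by rewrite /cabs/= !exprMn -mulrDr cos2Dsin2 mulr1 sqrtr_sqr ger0_norm ?expR_ge0.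
Qed.

Lemma cexp_expansion (R : realType) (e : R) : 0 < e ->
  exists2 d : R, 0 < d & forall s t : R, `|s| < d -> `|t| < d ->
    cabs (cexp s t - 1 - (s +i* t)%C) <= e * (`|s| + `|t|).
Proof.
move=> e0.
have [e' [e'0 e'1 e'e]] : exists e' : R, [/\ 0 < e', e' <= 1 & 6 * e' <= e].
  exists (Num.min (e / 6) 1); split.
  - by rewrite lt_min ltr01 andbT; apply: divr_gt0.
  - by rewrite ge_min lexx orbT.
  - by rewrite mulrC -ler_pdivlMr// ge_min lexx.
have [d1 d10 H1] := real_expansion (is_derive_expR (0 : R)) e'0.
have [d2 d20 H2] := real_expansion (is_derive_cos (0 : R)) e'0.
have [d3 d30 H3] := real_expansion (is_derive_sin (0 : R)) e'0.
pose d := Num.min (Num.min d1 d2) (Num.min d3 e').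
exists d; first by rewrite !lt_min d10 d20 d30 e'0.
move=> s t; rewrite /d !lt_min => /andP[/andP[s1 s2] /andP[s3 s4]].
move=> /andP[/andP[t1 t2] /andP[t3 t4]].
have := H1 s s1; rewrite add0r expR0 mul1r => {}H1.
have := H2 t t2; rewrite add0r cos0 sin0 oppr0 mul0r subr0 => {}H2.
have := H3 t t3; rewrite add0r cos0 sin0 subr0 mul1r => {}H3.
apply: (le_trans (cabs_le _)); rewrite /cexp/=.
have a0 : 0 <= `|s| by [].
have b0 : 0 <= `|t| by [].
have F1 : `|expR s - 1| <= 2 * `|s|.
  have := ler_normD (expR s - 1 - s) s; rewrite subrK => h.
  apply: (le_trans h); nra.
have G1 : `|expR s * cos t - 1 - s| <= 3 * e' * (`|s| + `|t|).
  have -> : expR s * cos t - 1 - s =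
      (expR s - 1 - s) + (expR s - 1) * (cos t - 1) + (cos t - 1) by ring.
  apply: (le_trans (ler_normD _ _)).
  have h1 := ler_normD (expR s - 1 - s) ((expR s - 1) * (cos t - 1)).
  rewrite normrM in h1.
  have h2 : `|expR s - 1| * `|cos t - 1| <= (2 * `|s|) * 1.
    by apply: ler_pM => //; nra.
  have h3 : `|expR s - 1| * `|cos t - 1| <= (2 * `|s|) * (e' * `|t|).
    by apply: ler_pM => //; nra.
  nra.
have G2 : `|expR s * sin t - t| <= 3 * e' * (`|s| + `|t|).
  have -> : expR s * sin t - t =
      (expR s - 1) * (sin t - t) + (expR s - 1) * t + (sin t - t) by ring.
  apply: (le_trans (ler_normD _ _)).
  have h1 := ler_normD ((expR s - 1) * (sin t - t)) ((expR s - 1) * t).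
  rewrite !normrM in h1.
  have h3 : `|expR s - 1| * `|sin t - t| <= (2 * `|s|) * (e' * `|t|).
    by apply: ler_pM => //; nra.
  have h4 : `|expR s - 1| * `|t| <= (2 * `|s|) * e'.
    by apply: ler_pM => //; nra.
  nra.
by rewrite oppr0 addr0; nra.
Qed.

(** Chain rule for g(exp(s + i t)): its derivative is the derivative c of g times
z = exp(s + i t), and al + i be = c z are the Cauchy-Riemann coefficients. *)
Lemma polar_cauchy_riemann (R : realType) (g : Cplx R -> Cplx R) (x y : R) :
  differentiable g (cexp x y) -> exists al be : R,
  forall e, 0 < e -> exists2 del, 0 < del & forall x' y',
    `|x' - x| < del -> `|y' - y| < del ->
    `|complex.Re (g (cexp x' y')) - complex.Re (g (cexp x y))
        - (al * (x' - x) - be * (y' - y))| <= e * (`|x' - x| + `|y' - y|) /\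
    `|complex.Im (g (cexp x' y')) - complex.Im (g (cexp x y))
        - (be * (x' - x) + al * (y' - y))| <= e * (`|x' - x| + `|y' - y|).
Proof.
set z := cexp x y => /cdifferentiable_expansion[c Hc].
pose ga := c * z.
exists (complex.Re ga), (complex.Im ga) => e e0.
have z0 : 0 <= cabs z := cabs_ge0 z.
have ga0 : 0 <= cabs ga := cabs_ge0 ga.
have [e1 e10 e1e] : exists2 e1 : R, 0 < e1 & e1 * (2 * cabs z) <= e / 2.
  exists (e / (4 * (cabs z + 1))); first by apply: divr_gt0 => //; lra.
  rewrite mulrAC ler_pdivrMr; last by lra.
  nra.
have [e2 [e20 e21 e2e]] : exists e2 : R, [/\ 0 < e2, e2 <= 1 & cabs ga * e2 <= e / 2].
  exists (Num.min (e / (2 * (cabs ga + 1))) 1); split.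
  - by rewrite lt_min ltr01 andbT; apply: divr_gt0 => //; lra.
  - by rewrite ge_min lexx orbT.
  - apply: (@le_trans _ _ (cabs ga * (e / (2 * (cabs ga + 1))))).
      by rewrite ler_wpM2l// ge_min lexx.
    rewrite mulrA ler_pdivrMr; last by lra.
    nra.
have [d1 d10 H1] := Hc _ e10.
have [d2 d20 H2] := cexp_expansion e20.
exists (Num.min d2 (d1 / (4 * (cabs z + 1)))).
  by rewrite lt_min d20; apply: divr_gt0 => //; lra.
move=> x' y'; rewrite !lt_min !ltr_pdivlMr; try lra.
set ds := x' - x; set dt := y' - y => /andP[ds2 ds1] /andP[dt2 dt1].
have {}H2 := H2 ds dt ds2 dt2.
set S := `|ds| + `|dt| in H2 *.
have S0 : 0 <= S by rewrite addr_ge0.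
pose h := z * (cexp ds dt - 1).
have zh : cexp x' y' = z + h.
  by rewrite /h mulrBr mulr1 addrC subrK -cexpD /ds /dt !(addrC x) !(addrC y) !subrK.
have hle : cabs h <= 2 * cabs z * S.
  have := cabsD (cexp ds dt - 1 - (ds +i* dt)%C) (ds +i* dt)%C; rewrite subrK => k.
  have k2 : cabs ((ds +i* dt)%C : Cplx R) <= S by exact: cabs_le.
  have k3 : cabs (cexp ds dt - 1) <= 2 * S by nra.
  by rewrite /h cabsM [2 * _]mulrC -mulrA ler_wpM2l.
have {}H1 : cabs (g (z + h) - g z - c * h) <= e1 * cabs h.
  by apply: H1; apply: (le_lt_trans hle); rewrite /S; nra.
have key : cabs (g (z + h) - g z - ga * (ds +i* dt)%C) <= e * S.
  have -> : g (z + h) - g z - ga * (ds +i* dt)%C = (g (z + h) - g z - c * h)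
      + ga * (cexp ds dt - 1 - (ds +i* dt)%C).
    by rewrite /h /ga; ring.
  apply: (le_trans (cabsD _ _)); rewrite cabsM.
  have : cabs ga * cabs (cexp ds dt - 1 - (ds +i* dt)%C) <= cabs ga * (e2 * S).
    by rewrite ler_wpM2l.
  have : e1 * cabs h <= e1 * (2 * cabs z * S) by rewrite ler_wpM2l// ltW.
  nra.
rewrite zh; split.
- apply: le_trans key; apply: le_trans (Re_le_cabs _).
  by rewrite !(cReD, cReN) cReM.
- apply: le_trans key; apply: le_trans (Im_le_cabs _).
  by rewrite !(cImD, cImN) cImM/= [X in _ - X]addrC.
Qed.

(** One half of the mean value property: the value at the centre is at most the
maximum over the circle.  The integral of Re g(exp(s + i t)) over a period in t
is the same for exp s = r and for exp s close to 0, the integrals over the two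
sides t = 0 and t = 2 pi being equal by periodicity.  It is at most 2 pi M for
exp s = r, and close to 2 pi Re g(0) for exp s close to 0 by continuity at 0. *)
Lemma punctured_mean_value_le (R : realType) (g : Cplx R -> Cplx R) (r rho M : R) :
  0 < r < rho -> {for 0, continuous g} ->
  (forall z, 0 < cabs z < rho -> differentiable g z) ->
  (forall z, cabs z = r -> complex.Re (g z) <= M) ->
  complex.Re (g 0) <= M.
Proof.
move=> /andP[r0 rrho] cg dg gM.
apply/ler_addgt0Pr => e e0.
have [d d0 Hd] := ccontinuous_bound cg e0.
(* t and r are the radii of the two circles that are compared. *)
pose t := Num.min (d / 2) r.
have [t0 tr td] : [/\ 0 < t, t <= r & t < d].
  split; rewrite /t ?lt_min ?ge_min ?lexx ?orbT ?r0 ?andbT ?gt_min//.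
    exact: divr_gt0.
  by rewrite ltr_pdivrMr//; apply/orP; left; lra.
pose a := ln t; pose b := ln r.
have ea : expR a = t by rewrite lnK.
have eb : expR b = r by rewrite lnK.
have ab : a <= b by rewrite -ler_expR ea eb.
(* Differentiability beyond |z| = r leaves room to the right of b = ln r, where
   primitives along horizontal lines are differentiable on both sides. *)
pose B := ln ((r + rho) / 2).
have eB : expR B = (r + rho) / 2 by rewrite lnK// posrE; lra.
have bB : b < B by rewrite -ltr_expR eb eB; lra.
pose u (x y : R) := complex.Re (g (cexp x y)).
pose v (x y : R) := complex.Im (g (cexp x y)).
have dgB x y : x <= B -> differentiable g (cexp x y).
  move=> xB; apply: dg; rewrite cabs_cexp expR_gt0/=.
  by rewrite (@le_lt_trans _ _ (expR B)) ?ler_expR// eB; lra.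
have cr x y : x <= B -> exists al be : R,
    forall e, 0 < e -> exists2 del, 0 < del & forall x' y',
      `|x' - x| < del -> `|y' - y| < del ->
      `|u x' y' - u x y - (al * (x' - x) - be * (y' - y))|
        <= e * (`|x' - x| + `|y' - y|) /\
      `|v x' y' - v x y - (be * (x' - x) + al * (y' - y))|
        <= e * (`|x' - x| + `|y' - y|).
  by move=> xB; apply: polar_cauchy_riemann; exact: dgB.
have cuv x y : x <= B -> {for y, continuous (u x)} /\ {for x, continuous (v^~ y)}.
  move=> /(cr x y)[al [be H]]; split; apply/cvgrPdist_le => e1 e10.
  - have [del del0 {}H] := H 1 ltr01.
    apply/nbhs_normP; exists (Num.min del (e1 / (1 + `|be|))) => /=.
      by rewrite lt_min del0 divr_gt0// ltr_pwDl.
    move=> y' /=; rewrite (distrC y) lt_min => /andP[h1].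
    rewrite ltr_pdivlMr ?ltr_pwDl// => h2.
    have [] := H x y'; rewrite ?subrr ?normr0//.
    rewrite mulr0 sub0r opprK mul1r add0r => k1 _.
    rewrite distrC -[_ - _](addrK (be * (y' - y))).
    rewrite (le_trans (ler_normB _ _))// normrM; nra.
  - have [del del0 {}H] := H 1 ltr01.
    apply/nbhs_normP; exists (Num.min del (e1 / (1 + `|be|))) => /=.
      by rewrite lt_min del0 divr_gt0// ltr_pwDl.
    move=> x' /=; rewrite (distrC x) lt_min => /andP[h1].
    rewrite ltr_pdivlMr ?ltr_pwDl// => h2.
    have [] := H x' y; rewrite ?subrr ?normr0//.
    rewrite !mulr0 !addr0 mul1r => _ k1.
    rewrite distrC -[_ - _](subrK (be * (x' - x))).
    rewrite (le_trans (ler_normD _ _))// normrM; nra.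
have pi0 : 0 < 2 * pi :> R by rewrite mulr_gt0 ?pi_gt0.
have [U dU] : exists U : R -> R -> R, forall x, x <= b -> forall y,
    -1 < y < 2 * pi + 1 -> is_derive y 1 (U x) (u x y).
  suff /choice[U HU] : forall x, exists Ux : R -> R, x <= b -> forall y,
      -1 < y < 2 * pi + 1 -> is_derive y 1 Ux (u x y) by exists U.
  move=> x; have [xb|] := leP x b; last by exists (fun=> 0) => + ?; lra.
  have [|Ux H] := @primitive_exists R (u x) (-1) (2 * pi + 1).
    by move=> y _; apply: (cuv x y _).1; lra.
  by exists Ux.
have [V dV] : exists V : R -> R -> R, forall y x,
    a - 1 < x < B -> is_derive x 1 (V^~ y) (v x y).
  suff /choice[V HV] : forall y, exists Vy : R -> R, forall x,
      a - 1 < x < B -> is_derive x 1 Vy (v x y) by exists (fun x y => V y x).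
  move=> y.
  have [|Vy H] := @primitive_exists R (v^~ y) (a - 1) B.
    by move=> x xB; apply: (cuv x y _).2; lra.
  by exists Vy.
have := @cauchy_riemann_flux R u v U V a b 0 (2 * pi) ab (ltW pi0).
have Veq : V b (2 * pi) - V a (2 * pi) - (V b 0 - V a 0) = 0.
  have [|c _] := @mean_value R (fun x => V x (2 * pi) - V x 0)
      (fun x => v x (2 * pi) - v x 0) a b ab.
    move=> x xab; have h1 : is_derive x 1 (V^~ (2 * pi)) (v x (2 * pi)).
      by apply: dV; lra.
    have h0 : is_derive x 1 (V^~ 0) (v x 0) by apply: dV; lra.
    exact: is_deriveB.
  rewrite (_ : v c (2 * pi) = v c 0) ?subrr ?mul0r.
    by move=> h; rewrite -[RHS]h; ring.
  by rewrite /v /cexp (_ : 2 * pi = 0 + pi *+ 2) ?cosD2pi ?sinD2pi// add0r mulr_natl.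
rewrite Veq => flux.
have {flux}Ueq : U b (2 * pi) - U b 0 - (U a (2 * pi) - U a 0) = 0.
  apply: flux.
  - by move=> x y xab y02; apply: dU; lra.
  - by move=> x y xab y02; apply: dV; lra.
  - move=> x y xab _; have [|al [be H]] := cr x y; first by lra.
    exists al, be => e1 /H[del del0 {}H]; exists del => // x' y' _ _; exact: H.
have Umvt x : x <= b -> exists y, U x (2 * pi) - U x 0 = u x y * (2 * pi).
  move=> xb; have [|y _ ->] := @mean_value R (U x) (u x) 0 (2 * pi) (ltW pi0).
    by move=> y y02; apply: dU => //; lra.
  by exists y; rewrite subr0.
have [yb Yb] := Umvt b (lexx _).
have [ya Ya] := Umvt a ab.
have ub : u b yb <= M by apply: gM; rewrite cabs_cexp.
have ua : complex.Re (g 0) - e <= u a ya.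
  have := Hd (cexp a ya); rewrite cabs_cexp ea add0r => /(_ td) h.
  have := le_lt_trans (Re_le_cabs _) h.
  by rewrite cReD cReN -/(u a ya) ltr_norml; lra.
have : u b yb = u a ya.
  apply: (mulIf (lt0r_neq0 pi0)); rewrite -Yb -Ya; apply/eqP.
  by rewrite -subr_eq0 Ueq.
lra.
Qed.

Lemma disk_compact (R : realType) (r : R) :
  compact [set p : R * R | p.1 ^+ 2 + p.2 ^+ 2 <= r ^+ 2].
Proof.
apply: (@subclosed_compact _ _ (`[- `|r|, `|r|] `*` `[- `|r|, `|r|])).
- rewrite (_ : [set p | _] =
    (fun p : R * R => p.1 ^+ 2 + p.2 ^+ 2) @^-1` [set x | x <= r ^+ 2])//.
  apply: closed_comp; last exact: closed_le.
  move=> p _; apply: cvgD; apply: continuous_comp (@exprn_continuous _ _ _).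
    exact: cvg_fst.
  exact: cvg_snd.
- by apply: compact_setX; exact: segment_compact.
- move=> [x y] /= h; split; rewrite /= in_itv/= -ler_norml -ler_sqr ?nnegrE//.
    by rewrite !real_normK ?num_real//; have := sqr_ge0 y; lra.
  by rewrite !real_normK ?num_real//; have := sqr_ge0 x; lra.
Qed.

Lemma continuous_Re_comp (R : realType) (g : Cplx R -> Cplx R) (p : R * R) :
  {for (p.1 +i* p.2)%C, continuous g} ->
  {for p, continuous (fun q : R * R => complex.Re (g (q.1 +i* q.2)%C))}.
Proof.
move=> cg; apply/cvgrPdist_lt => e e0.
have [d d0 H] := ccontinuous_bound cg e0.
exists (ball p.1 (d / 2), ball p.2 (d / 2)).
  by split; apply: nbhsx_ballx; rewrite divr_gt0.
move=> q /= [/=]; rewrite -!ball_normE /= => h1 h2.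
pose h : Cplx R := ((q.1 - p.1) +i* (q.2 - p.2))%C.
have -> : (q.1 +i* q.2)%C = (p.1 +i* p.2)%C + h :> Cplx R.
  by apply/eqP; rewrite eq_complex/= !subrKC !eqxx.
rewrite distrC -cReN -cReD (le_lt_trans (Re_le_cabs _))// H//.
apply: (le_lt_trans (cabs_le _)); rewrite /= distrC (distrC q.2); lra.
Qed.

(** If Re g exceeded M somewhere, Re g + e |z|^2 would reach its maximum over the
closed disk at an interior point z1 for small e > 0.  Since
|z1 + h|^2 = |z1|^2 + 2 Re (z1^* h) + |h|^2, this makes the real part of
G(h) = g(z1 + h) + 2 e z1^* h smaller than that of G(0) by at least e |h|^2 for
all small h, which the mean value property forbids. *)
Lemma punctured_max_principle (R : realType) (g : Cplx R -> Cplx R) (r M : R) :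
  (forall z, cabs z <= r -> {for z, continuous g}) ->
  (forall z, 0 < cabs z < r -> differentiable g z) ->
  (forall z, cabs z = r -> complex.Re (g z) <= M) ->
  forall z, cabs z <= r -> complex.Re (g z) <= M.
Proof.
move=> cg dg gM z0 z0r; rewrite leNgt; apply/negP => Mz0.
have r0 : 0 <= r by exact: le_trans (cabs_ge0 z0) z0r.
(* Small enough for e |z|^2 not to move the maximum to the circle |z| = r. *)
pose e := (complex.Re (g z0) - M) / (2 * (r ^+ 2 + 1)).
have r21 : 0 < 2 * (r ^+ 2 + 1) by have := sqr_ge0 r; lra.
have e0 : 0 < e by rewrite divr_gt0// subr_gt0.
have er : e * r ^+ 2 < complex.Re (g z0) - M.
  have : e * (2 * (r ^+ 2 + 1)) = complex.Re (g z0) - M.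
    by rewrite /e divfK// gt_eqF.
  have := sqr_ge0 r; nra.
pose phi (p : R * R) := complex.Re (g (p.1 +i* p.2)%C) + e * (p.1 ^+ 2 + p.2 ^+ 2).
have inA z : cabs z <= r -> [set p : R * R | p.1 ^+ 2 + p.2 ^+ 2 <= r ^+ 2]
     (complex.Re z, complex.Im z).
  by move=> zr; rewrite /= -cabs_sqrE ler_sqr// nnegrE cabs_ge0.
have [||[x1 y1]] := compact_EVT_max _ (@disk_compact R r) (f := phi).
- by exists (complex.Re z0, complex.Im z0); exact: inA.
- apply: continuous_in_subspaceT => p; rewrite inE /= => pr.
  apply: cvgD.
    apply: continuous_Re_comp; apply: cg.
    by rewrite -ler_sqr ?nnegrE ?cabs_ge0// cabs_sqrE.
  apply: cvgMr; apply: cvgD; apply: continuous_comp (@exprn_continuous _ _ _).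
    exact: cvg_fst.
  exact: cvg_snd.
rewrite inE /= => z1r phimax.
pose z1 : Cplx R := (x1 +i* y1)%C.
have z1E : cabs z1 ^+ 2 = x1 ^+ 2 + y1 ^+ 2 by rewrite cabs_sqrE.
have {phimax}max z : cabs z <= r ->
    complex.Re (g z) + e * cabs z ^+ 2 <= complex.Re (g z1) + e * cabs z1 ^+ 2.
  case: z => a b /inA; rewrite -inE => /phimax; rewrite !cabs_sqrE; exact.
have z1r' : cabs z1 <= r by rewrite -ler_sqr ?nnegrE ?cabs_ge0// z1E.
have {z1r'}z1r' : cabs z1 < r.
  rewrite lt_neqAle z1r' andbT; apply/eqP => z1r''.
  have := max z0 z0r; have := gM z1 z1r''; rewrite z1r''.
  have := sqr_ge0 (cabs z0); nra.
have [s s0 hs] : exists2 s, 0 < s & forall h, 0 < cabs h < s -> 0 < cabs (z1 + h) < r.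
  have [z10|z10] := eqVneq z1 0.
    by exists r => [|h]; rewrite ?(le_lt_trans (cabs_ge0 _) z1r')// z10 add0r.
  exists (Num.min (r - cabs z1) (cabs z1)).
    by rewrite lt_min subr_gt0 z1r' cabs_gt0.
  move=> h; rewrite lt_min => /and3P[h0 h1 h2]; apply/andP; split.
    have := cabsD (z1 + h) (- h); rewrite addrK cabsN; lra.
  by rewrite (le_lt_trans (cabsD _ _))//; lra.
pose c : Cplx R := (2 * e)%:C%C * z1^*.
pose G h : Cplx R := g (z1 + h) + c * h.
suff : complex.Re (G 0) <= complex.Re (g z1) - e * (s / 2) ^+ 2.
  have s2 : 0 < e * (s / 2) ^+ 2 by rewrite mulr_gt0// exprn_gt0// divr_gt0.
  rewrite /G mulr0 !addr0; lra.
apply: (@punctured_mean_value_le R G (s / 2) s); first by rewrite divr_gt0//=; lra.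
- apply: (@continuousD _ _ _ (fun h => g (z1 + h)) (fun h => c * h)).
    apply: (@continuous_comp _ _ _ (fun h => z1 + h) g).
      exact/differentiable_continuous/differentiableD.
    by apply: cg; rewrite addr0 ltW.
  exact/differentiable_continuous/differentiableM.
- move=> h /hs/dg/differentiable_comp_addl dgh.
  exact: (differentiableD dgh (differentiable_mull c h)).
- move=> h hs2.
  have := max (z1 + h); rewrite /G cReD.
  have -> : complex.Re (c * h) = e * (cabs (z1 + h) ^+ 2 - cabs z1 ^+ 2 - cabs h ^+ 2).
    rewrite !cabs_sqrE /c; case: h hs2 => a b _ /=; ring.
  have /andP[_ /ltW hr] : 0 < cabs (z1 + h) < r by apply: hs; rewrite hs2; lra.
  move=> /(_ hr); rewrite hs2; lra.
Qed.

(** * The Schwarz lemma at the boundary *)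

(** For fixed z, the real part of g(z)^* g(w) is at most |g(z)| M on the circle,
and it is |g(z)|^2 at w = z. *)
Lemma punctured_max_modulus (R : realType) (g : Cplx R -> Cplx R) (r M : R) :
  (forall z, cabs z <= r -> {for z, continuous g}) ->
  (forall z, 0 < cabs z < r -> differentiable g z) ->
  (forall z, cabs z = r -> cabs (g z) <= M) ->
  0 <= M -> forall z, cabs z <= r -> cabs (g z) <= M.
Proof.
move=> cg dg gM M0 z zr.
have [gz0|gz0] := eqVneq (g z) 0; first by rewrite gz0 cabs0.
have gzgt0 : 0 < cabs (g z) by rewrite cabs_gt0.
pose G w := (g z)^* * g w.
have ReG : complex.Re (G z) = cabs (g z) ^+ 2.
  by rewrite cabs_sqrE /G; case: (g z) => a b /=; ring.
suff : complex.Re (G z) <= cabs (g z) * M by rewrite ReG expr2 ler_pM2l.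
apply: (@punctured_max_principle R G r); last exact: zr.
- move=> w /cg cgw.
  exact: (@continuousM _ _ (fun=> (g z)^*) g _ (@cst_continuous _ _ _ _) cgw).
- move=> w /dg dgw.
  exact: (@differentiableM _ _ (fun=> (g z)^*) g _ (@differentiable_cst _ _ _ _ _) dgw).
- move=> w /gM gwM; apply: (le_trans (ler_norm _)).
  by rewrite (le_trans (Re_le_cabs _))// /G cabsM cabsJ ler_wpM2l// cabs_ge0.
Qed.

Lemma pseudo_hyperbolic_identity (R : realType) (a u : Cplx R) :
  cabs (1 - a^* * u) ^+ 2 - cabs (u - a) ^+ 2 =
  (1 - cabs a ^+ 2) * (1 - cabs u ^+ 2).
Proof. by rewrite !cabs_sqrE; case: a => a b; case: u => c d /=; ring. Qed.

(** Schwarz's lemma for k = (g - g(0)) / (1 - g(0)^* g), which maps the disk to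
itself and vanishes at 0, in a form free of quotients. *)
Lemma schwarz_pick0 (R : realType) (g : Cplx R -> Cplx R) :
  (forall w, cabs w < 1 -> differentiable g w) ->
  (forall w, cabs w < 1 -> cabs (g w) < 1) ->
  forall w, cabs w < 1 ->
  cabs (g w - g 0) <= cabs w * cabs (1 - (g 0)^* * g w).
Proof.
move=> dg g1 w0 w01.
set a := g 0.
have a1 : cabs a < 1 by apply: g1; rewrite cabs0.
have den w : cabs w < 1 -> 0 < cabs (1 - a^* * g w).
  move=> /g1 gw; have := cabsD (1 - a^* * g w) (a^* * g w).
  rewrite subrK cabs1 cabsM cabsJ.
  have := cabs_ge0 a; have := cabs_ge0 (g w); nra.
pose k w := (g w - a) / (1 - a^* * g w).
have cabsk w : cabs (k w) = cabs (g w - a) / cabs (1 - a^* * g w).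
  by rewrite /k cabsM cabsV.
have dk w : cabs w < 1 -> differentiable k w.
  move=> w1; have dgw := dg w w1.
  apply: differentiableM.
    exact: (differentiableB dgw (@differentiable_cst _ _ _ _ _)).
  apply: differentiableV; last by rewrite -cabs_gt0 den.
  have dag := differentiable_comp dgw (@differentiable_mull R a^* (g w)).
  exact: (differentiableB (@differentiable_cst _ _ _ _ _) dag).
have k1 w : cabs w < 1 -> cabs (k w) <= 1.
  move=> w1; rewrite cabsk ler_pdivrMr ?den// mul1r -ler_sqr ?nnegrE ?cabs_ge0//.
  rewrite -subr_ge0 pseudo_hyperbolic_identity mulr_ge0// subr_ge0.
    by rewrite expr_le1 ?cabs_ge0// ltW.
  by rewrite expr_le1 ?cabs_ge0// ltW// g1.
have k0 : k 0 = 0 by rewrite /k -/a subrr mul0r.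
rewrite -ler_pdivrMr ?den// -cabsk.
have [->|w00] := eqVneq w0 0; first by rewrite k0 cabs0.
have w0gt0 : 0 < cabs w0 by rewrite cabs_gt0.
have [c Hc] := cdifferentiable_expansion (dk 0 ltac:(by rewrite cabs0)).
(* With x / 0 = 0, the quotient (k w - c w) / w is 0 at w = 0, which is its limit
   there; so K + c is the continuous extension of k w / w. *)
pose K w := (k w - c * w) / w.
have KE w : w != 0 -> K w + c = k w / w.
  by move=> w_neq0; rewrite /K mulrBl mulfK// subrK.
have dK w : 0 < cabs w < 1 -> differentiable (fun w => K w + c) w.
  move=> /andP[wgt0 w1]; apply: differentiableD; last exact: differentiable_cst.
  apply: differentiableM; last by apply: differentiableV; rewrite // -cabs_gt0.
  by apply: differentiableB; [exact: dk|apply: differentiableM].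
have cK w : cabs w < 1 -> {for w, continuous (fun w => K w + c)}.
  move=> w1; have [->|w_neq0] := eqVneq w 0; last first.
    by apply: differentiable_continuous; apply: dK; rewrite w1 cabs_gt0 w_neq0.
  apply: ccontinuous_intro => e e0.
  have [d d0 Hd] := Hc _ e0; exists d => // h hd.
  rewrite add0r opprD addrACA subrr addr0.
  rewrite /K invr0 mulr0 subr0 cabsM cabsV.
  have [->|h0] := eqVneq h 0; first by rewrite cabs0 invr0 mulr0 ltW.
  rewrite ler_pdivrMr ?cabs_gt0//.
  by have := Hd h; rewrite add0r k0 subr0; apply.
have bound r : cabs w0 <= r -> r < 1 -> cabs (k w0) * r <= cabs w0.
  move=> w0r r1; have r0 : 0 < r := lt_le_trans w0gt0 w0r.
  have : cabs (K w0 + c) <= r^-1.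
    apply: (@punctured_max_modulus R (fun w => K w + c) r); last exact: w0r.
    - by move=> w wr; apply: cK; exact: le_lt_trans wr r1.
    - by move=> w /andP[wgt0 wr]; apply: dK; rewrite wgt0 (lt_trans wr).
    - move=> w wr; rewrite KE -?cabs_gt0 ?wr// cabsM cabsV wr.
      by rewrite ler_piMl ?k1 ?wr// invr_ge0 ltW.
    - by rewrite invr_ge0 ltW.
  by rewrite KE// cabsM cabsV ler_pdivrMr// mulrC ler_pdivlMr.
(* The bound tends to the claim as r tends to 1; if |k w0| > |w0|, it already
   fails at the midpoint r of |w0| / |k w0| and 1. *)
rewrite leNgt; apply/negP => ltk.
have kgt0 : 0 < cabs (k w0) := lt_trans w0gt0 ltk.
have k1w0 := k1 w0 w01.
set q := cabs w0 / cabs (k w0).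
have q1 : q < 1 by rewrite /q ltr_pdivrMr// mul1r.
have qE : q * cabs (k w0) = cabs w0 by rewrite /q divfK// gt_eqF.
have qw : cabs w0 <= q.
  by rewrite -qE; rewrite ler_piMr// divr_ge0// ltW.
have := bound ((1 + q) / 2) ltac:(lra) ltac:(lra).
nra.
Qed.

Lemma le_of_linear_slack (R : realType) (x y K : R) :
  (forall e, 0 < e <= 1 -> x <= y + e * K) -> x <= y.
Proof.
move=> H; rewrite leNgt; apply/negP => yx.
have K0 : 0 < K by have := H 1; rewrite ltr01 lexx => /(_ isT); lra.
pose e := Num.min 1 ((x - y) / (2 * K)).
have e0 : 0 < e by rewrite lt_min ltr01 divr_gt0 ?mulr_gt0 ?subr_gt0.
have e1 : e <= 1 by rewrite ge_min lexx.
have : e * (2 * K) <= x - y by rewrite -ler_pdivlMr ?mulr_gt0// ge_min lexx orbT.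
have := H e; rewrite e0 e1 => /(_ isT); lra.
Qed.

(** The value lambda plays the role of the derivative of g at the boundary point
1, taken along the radius.  By [pseudo_hyperbolic_identity] the estimate of
[schwarz_pick0] at w = 1 - t reads
(1 - w^2) |1 - g(0)^* g(w)|^2 <= (1 - |g(0)|^2) (1 - |g(w)|^2), where
1 - |g(w)|^2 <= 2 (lambda + e) t and 1 - w^2 = (2 - t) t. *)
Lemma boundary_schwarz (R : realType) (g : Cplx R -> Cplx R) (lambda : R) :
  (forall w, cabs w < 1 -> differentiable g w) ->
  (forall w, cabs w < 1 -> cabs (g w) < 1) ->
  0 <= lambda ->
  (forall e, 0 < e -> exists2 d, 0 < d & forall t, 0 < t < d ->
    cabs (g (1 - t)%:C%C - (1 - lambda * t)%:C%C) <= e * t) ->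
  cabs (1 - (g 0)^*) ^+ 2 / (1 - cabs (g 0) ^+ 2) <= lambda.
Proof.
move=> dg g1 la0 Hla.
set a := g 0.
have a1 : cabs a < 1 by apply: g1; rewrite cabs0.
have a0 : 0 <= cabs a := cabs_ge0 a.
set D := cabs (1 - a^*); set m := 1 - cabs a ^+ 2.
have D0 : 0 <= D := cabs_ge0 _.
have m0 : 0 < m by rewrite /m; nra.
rewrite ler_pdivrMr//.
apply: (@le_of_linear_slack R _ _ (m + D ^+ 2 + 2 * D * (lambda + 1))).
move=> e /andP[e0 e1].
have [d d0 Hd] := Hla e e0.
pose t := Num.min e d / 2.
have med : 0 < Num.min e d by rewrite lt_min e0.
have [t0 te td] : [/\ 0 < t, 2 * t <= e & t < d].
  have : Num.min e d <= e by rewrite ge_min lexx.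
  have : Num.min e d <= d by rewrite ge_min lexx orbT.
  by rewrite /t; split; lra.
have {Hd} := Hd t; rewrite t0 td => /(_ isT).
pose w : Cplx R := (1 - t)%:C%C.
have wE : cabs w = 1 - t by rewrite cabs_real ger0_norm//; lra.
have w1 : cabs w < 1 by rewrite wE; lra.
rewrite -/w; set u := g w => Hu.
have u1 : cabs u < 1 := g1 w w1.
have := schwarz_pick0 dg g1 w1; rewrite -/a -/u wE => SP.
have := pseudo_hyperbolic_identity a u; rewrite -/m.
set X := cabs (1 - a^* * u) in SP *; set Y := cabs (u - a) in SP *.
have X0 : 0 <= X := cabs_ge0 _.
have Y0 : 0 <= Y := cabs_ge0 _.
move=> idXY.
have Reu : 1 - cabs u ^+ 2 <= 2 * (lambda + e) * t.
  have h1 := le_trans (Re_le_cabs _) Hu.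
  move: h1; rewrite cReD cReN/= ler_norml => /andP[h1 _].
  rewrite cabs_sqrE; have := sqr_ge0 (complex.Im u).
  have := sqr_ge0 (1 - complex.Re u); lra.
have XD : D <= X + (lambda + e) * t.
  rewrite /D (_ : 1 - a^* = (1 - a^* * u) + a^* * (u - 1)); last by ring.
  apply: (le_trans (cabsD _ _)); rewrite lerD2l cabsM cabsJ.
  have : cabs (u - 1) <= (lambda + e) * t.
    have -> : u - 1 = (u - (1 - lambda * t)%:C%C) + (- (lambda * t))%:C%C.
      by rewrite !rmorphB rmorphN /=; ring.
    apply: (le_trans (cabsD _ _)); rewrite cabs_real normrN ger0_norm; last by nra.
    lra.
  have := cabs_ge0 (u - 1); nra.
have XD2 : D ^+ 2 - 2 * D * (lambda + 1) * t <= X ^+ 2.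
  have h : (lambda + e) * t <= (lambda + 1) * t by rewrite ler_wpM2r//; lra.
  have [DX|XD'] := leP D X.
    have : 0 <= D * (lambda + 1) * t by rewrite !mulr_ge0//; lra.
    nra.
  have : D * (D - X) <= D * ((lambda + 1) * t) by rewrite ler_wpM2l//; lra.
  nra.
have key : (2 - t) * t * X ^+ 2 <= m * (2 * (lambda + e) * t).
  have : m * (1 - cabs u ^+ 2) <= m * (2 * (lambda + e) * t) by rewrite ler_wpM2l// ltW.
  have : Y ^+ 2 <= ((1 - t) * X) ^+ 2.
    by rewrite ler_sqr ?nnegrE// mulr_ge0//; lra.
  rewrite -idXY exprMn; lra.
have {}key : (2 - t) * X ^+ 2 <= 2 * m * (lambda + e).
  rewrite -(ler_pM2r t0); lra.
have h : (2 - t) * (D ^+ 2 - 2 * D * (lambda + 1) * t) <= (2 - t) * X ^+ 2.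
  by rewrite ler_wpM2l//; lra.
have h2 : 0 <= t ^+ 2 * (2 * D * (lambda + 1)).
  by rewrite mulr_ge0 ?sqr_ge0// !mulr_ge0//; lra.
have h3 : (2 * t) * (D ^+ 2 + 4 * D * (lambda + 1))
    <= e * (D ^+ 2 + 4 * D * (lambda + 1)).
  by rewrite ler_wpM2r// addr_ge0 ?sqr_ge0// !mulr_ge0//; lra.
have h4 : 0 <= e * D ^+ 2 by rewrite mulr_ge0 ?sqr_ge0// ltW.
have h5 : 0 <= e * (D * (lambda + 1)) by rewrite !mulr_ge0//; lra.
lra.
Qed.

(** * Points and slices of C^2 *)

Lemma enorm_sqr (R : realType) (k : nat) (v : 'rV[Cplx R]_k) :
  enorm v ^+ 2 = \sum_(i < k) cabs (v 0 i) ^+ 2.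
Proof. by rewrite sqr_sqrtr// sumr_ge0// => i _; exact: sqr_ge0. Qed.

Lemma coord_le_norm (R : realType) (k : nat) (v : 'rV[Cplx R]_k) (i : 'I_k) :
  `|v 0 i| <= `|v|.
Proof.
rewrite [leRHS]mx_normE.
exact: (le_bigmax _ (fun i => `|v i.1 i.2|%:nng) (0, i)).
Qed.

Definition pt (R : realType) (z w : Cplx R) : 'rV[Cplx R]_(1 + 1) :=
  row_mx z%:M w%:M.

Notation zcoord := (lshift 1 ord0 : 'I_(1 + 1)).
Notation wcoord := (rshift 1 ord0 : 'I_(1 + 1)).

Lemma ptD (R : realType) (z w z' w' : Cplx R) :
  pt z w + pt z' w' = pt (z + z') (w + w').
Proof. by rewrite /pt add_row_mx !raddfD. Qed.

Lemma ptE (R : realType) (z w : Cplx R) :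
  pt z w = z *: pt 1 0 + w *: pt 0 1.
Proof.
by rewrite /pt !scale_row_mx !scale_scalar_mx ptD !mulr1 !mulr0 addr0 add0r.
Qed.

Lemma pt_z (R : realType) (z w : Cplx R) : pt z w 0 zcoord = z.
Proof. by rewrite row_mxEl mxE. Qed.

Lemma pt_w (R : realType) (z w : Cplx R) : pt z w 0 wcoord = w.
Proof. by rewrite row_mxEr mxE. Qed.

Lemma bpoint11 (R : realType) : bpoint R 1 1 = pt 0 1.
Proof.
rewrite /bpoint /pt raddf0; congr row_mx.
by apply/rowP => j; rewrite !mxE ord1.
Qed.

Lemma pt00 (R : realType) : pt 0 0 = 0 :> 'rV[Cplx R]_(1 + 1).
Proof. by rewrite /pt !raddf0 row_mx0. Qed.

Lemma norm_pt (R : realType) (z w : Cplx R) :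
  `|pt z w| <= (cabs z + cabs w)%:C%C.
Proof.
have [->|] := eqVneq `|pt z w| 0; first by rewrite ler0c addr_ge0 ?cabs_ge0.
move=> /mx_norm_neq0[[i j] /= npt].
rewrite [leLHS]npt (ord1 i) cabs_normE lecR.
case: (split_ordP j) => j' ->; rewrite (ord1 j').
  by rewrite pt_z lerDl cabs_ge0.
by rewrite pt_w lerDr cabs_ge0.
Qed.

Lemma FBH_pt (R : realType) (z w : Cplx R) :
  FBH R 1 1 (pt z w) <-> cabs w ^+ 2 < expR (- cabs z ^+ 2).
Proof.
by rewrite /FBH /= !enorm_sqr !big_ord1 /pt row_mxKl row_mxKr !mxE.
Qed.

Lemma FBH_pt_ball (R : realType) (z w : Cplx R) :
  cabs w ^+ 2 + cabs z ^+ 2 < 1 -> FBH R 1 1 (pt z w).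
Proof. by move=> h; apply/FBH_pt; have := expR_ge1Dx (- cabs z ^+ 2); lra. Qed.

Lemma cjac_expansion (R : realType) (k : nat)
    (F : 'rV[Cplx R]_(1 + 1) -> 'rV[Cplx R]_k) (x : 'rV[Cplx R]_(1 + 1)) (i : 'I_k) :
  differentiable F x ->
  forall e, 0 < e -> exists2 d, 0 < d & forall z w, cabs z + cabs w < d ->
    cabs (F (x + pt z w) 0 i - F x 0 i
          - (cjac F x i zcoord * z + cjac F x i wcoord * w))
      <= e * (cabs z + cabs w).
Proof.
move=> dF e e0.
have [d d0 H] := differentiable_expansion dF e0.
exists d => // z w zwd.
have npt := norm_pt z w.
have := H (pt z w) (le_lt_trans npt _); rewrite ltcR => /(_ zwd) {}H.
have {}H := le_trans (coord_le_norm _ i) H; rewrite !mxE in H.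
move: H.
have -> : 'd F x (pt z w) 0 i = cjac F x i zcoord * z + cjac F x i wcoord * w.
  rewrite -(mul_rV_lin1 ('d F x)) mxE big_split_ord !big_ord1 pt_z pt_w.
  by congr (_ + _); rewrite mulrC [cjac _ _ _ _]mxE.
rewrite cabs_normE => {}H.
have : (cabs (F (x + pt z w) 0 i - F x 0 i -
    (cjac F x i zcoord * z + cjac F x i wcoord * w)))%:C%C
     <= (e * (cabs z + cabs w))%:C%C :> Cplx R.
  by rewrite (le_trans H)// rmorphM/= ler_wpM2l// ler0c ltW.
by rewrite lecR.
Qed.

Lemma differentiable_coord_comp (R : realType) (k l : nat)
    (F : 'rV[Cplx R]_k -> 'rV[Cplx R]_l) (x : 'rV[Cplx R]_k) (i : 'I_l) :
  differentiable F x -> differentiable (fun y => F y 0 i : Cplx R) x.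
Proof.
move=> dF.
exact: (differentiable_comp dF (@differentiable_coord _ _ _ (F x) 0 i)).
Qed.

Lemma differentiable_pt_z (R : realType) (z w : Cplx R) :
  differentiable (fun z => pt z w) z.
Proof.
rewrite (_ : (fun z => pt z w) = (fun z => z *: pt 1 0) + cst (w *: pt 0 1)).
  apply: differentiableD; last exact: differentiable_cst.
  exact: (@differentiableZl _ _ _ id).
by apply/funext => z' /=; rewrite fctE/= ptE.
Qed.

Lemma differentiable_pt_w (R : realType) (z w : Cplx R) :
  differentiable (fun w => pt z w) w.
Proof.
rewrite (_ : (fun w => pt z w) = cst (z *: pt 1 0) + (fun w => w *: pt 0 1)).
  apply: differentiableD; first exact: differentiable_cst.
  exact: (@differentiableZl _ _ _ id).
by apply/funext => z' /=; rewrite fctE/= ptE.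
Qed.

Lemma differentiable_slice_z (R : realType) (l : nat)
    (F : 'rV[Cplx R]_(1 + 1) -> 'rV[Cplx R]_l) (z w : Cplx R) (i : 'I_l) :
  differentiable F (pt z w) -> differentiable (fun z => F (pt z w) 0 i) z.
Proof.
move=> /(@differentiable_coord_comp _ _ _ _ _ i).
exact: (differentiable_comp (differentiable_pt_z z w)).
Qed.

Lemma differentiable_slice_w (R : realType) (l : nat)
    (F : 'rV[Cplx R]_(1 + 1) -> 'rV[Cplx R]_l) (z w : Cplx R) (i : 'I_l) :
  differentiable F (pt z w) -> differentiable (fun w => F (pt z w) 0 i) w.
Proof.
move=> /(@differentiable_coord_comp _ _ _ _ _ i).
exact: (differentiable_comp (differentiable_pt_w z w)).
Qed.

(** * Derivatives at the boundary point *)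

(** With T = |z|^2 and W = |w|^2 for y = (z, w), the sum on the left is T + W, and
W < exp(-T) <= 1 - T + T^2, while T <= S. *)
Lemma FBH_coord_bound (R : realType) (n m : nat) (y : 'rV[Cplx R]_(n + m)) (j : 'I_m) :
  FBH R n m y ->
  let S := \sum_(i | i != rshift n j) cabs (y 0 i) ^+ 2 in
  cabs (y 0 (rshift n j)) ^+ 2 + S <= 1 + S ^+ 2.
Proof.
rewrite /FBH /= !enorm_sqr => yD.
set S := \sum_(i | _) _.
have tot : cabs (y 0 (rshift n j)) ^+ 2 + S = \sum_i cabs (y 0 i) ^+ 2.
  by rewrite (bigD1 (rshift n j)).
rewrite tot big_split_ord /=.
set T := \sum_(i < n) _; set W := \sum_(i < m) _.
have WE : \sum_(i < m) cabs (rsubmx y 0 i) ^+ 2 = W.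
  by apply: eq_bigr => i _; rewrite mxE.
have TE : \sum_(i < n) cabs (lsubmx y 0 i) ^+ 2 = T.
  by apply: eq_bigr => i _; rewrite mxE.
rewrite WE TE in yD.
have T0 : 0 <= T by apply: sumr_ge0 => i _; exact: sqr_ge0.
have TS : T <= S.
  move: tot; rewrite big_split_ord /= -/T -/W => tot.
  have : cabs (y 0 (rshift n j)) ^+ 2 <= W.
    by rewrite /W (bigD1 j)//= lerDl sumr_ge0// => i _; exact: sqr_ge0.
  lra.
have TS2 : T ^+ 2 <= S ^+ 2 by rewrite ler_sqr// nnegrE// (le_trans T0).
have eT : expR (- T) * (1 + T) <= 1.
  have := expR_ge1Dx T; have := expR_gt0 (- T).
  have : expR (- T) * expR T = 1 by rewrite -expRD addNr expR0.
  nra.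
have : expR (- T) <= 1 - T + T ^+ 2.
  rewrite -(ler_pM2r (_ : 0 < 1 + T)); last by lra.
  have : 0 <= T * T ^+ 2 by rewrite mulr_ge0// sqr_ge0.
  nra.
lra.
Qed.

Lemma FBH_coord_lt1 (R : realType) (n m : nat) (y : 'rV[Cplx R]_(n + m)) (j : 'I_m) :
  FBH R n m y -> cabs (y 0 (rshift n j)) < 1.
Proof.
rewrite /FBH /= !enorm_sqr => yD.
have : \sum_(i < m) cabs (rsubmx y 0 i) ^+ 2 < 1.
  apply: (lt_le_trans yD); rewrite -[leRHS]expR0 ler_expR oppr_le0.
  by apply: sumr_ge0 => i _; exact: sqr_ge0.
rewrite (bigD1 j)//= mxE => h.
have : 0 <= \sum_(i < m | i != j) cabs (rsubmx y 0 i) ^+ 2.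
  by apply: sumr_ge0 => i _; exact: sqr_ge0.
by have := cabs_ge0 (y 0 (rshift n j)); nra.
Qed.

Lemma bpoint_coord (R : realType) (n m : nat) (hm : (0 < m)%N) (i : 'I_(n + m)) :
  bpoint R n m 0 i = (i == rshift n (Ordinal hm))%:R.
Proof.
rewrite /bpoint; case: (split_ordP i) => k ->.
  by rewrite row_mxEl mxE eq_lrshift.
by rewrite row_mxEr mxE eq_rshift -val_eqE.
Qed.

(** If Re b < 0 then |1 + t b|^2 + |t a|^2 < 1 for small t > 0, so the point
(0, 1) + t (a, b) is in the domain, where Re (F_i) < 1. *)
Lemma inward_derivative_le0 (R : realType) (k : nat)
    (F : 'rV[Cplx R]_(1 + 1) -> 'rV[Cplx R]_k) (i : 'I_k) :
  (forall x, FBH R 1 1 x -> cabs (F x 0 i) < 1) ->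
  differentiable F (pt 0 1) -> F (pt 0 1) 0 i = 1 ->
  forall a b, complex.Re b < 0 ->
  complex.Re (cjac F (pt 0 1) i zcoord * a + cjac F (pt 0 1) i wcoord * b) <= 0.
Proof.
move=> F1 dF Fp a b b0.
set L := _ + _; rewrite leNgt; apply/negP => L0.
pose N := cabs a + cabs b.
have N0 : 0 <= N by rewrite addr_ge0 ?cabs_ge0.
pose Q := cabs a ^+ 2 + cabs b ^+ 2.
have Q0 : 0 <= Q by rewrite addr_ge0 ?sqr_ge0.
pose e := complex.Re L / (2 * (N + 1)).
have e0 : 0 < e by apply: divr_gt0 => //; lra.
have eE : e * (2 * (N + 1)) = complex.Re L by rewrite divfK// gt_eqF//; lra.
have [d d0 H] := cjac_expansion i dF e0.
have [t [t0 td tb]] : exists t,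
    [/\ 0 < t, t * (N + 1) < d & t * (Q + 1) <= - complex.Re b].
  exists (Num.min (d / (2 * (N + 1))) (- complex.Re b / (Q + 1))); split.
  - by rewrite lt_min; apply/andP; split; apply: divr_gt0; lra.
  - apply: (@le_lt_trans _ _ (d / (2 * (N + 1)) * (N + 1))).
      by rewrite ler_wpM2r ?ge_min ?lexx//; lra.
    have -> : d / (2 * (N + 1)) * (N + 1) = d / 2.
      by field; rewrite gt_eqF//; lra.
    by rewrite ltr_pdivrMr// mulr_natr mulr2n ltrDr.
  - rewrite -ler_pdivlMr; last by lra.
    by rewrite ge_min lexx orbT.
pose u : Cplx R := t%:C%C.
have ut z : cabs (u * z) = t * cabs z by rewrite cabsM cabs_real gtr0_norm.
have {H} := H (u * a) (u * b); rewrite !ut -mulrDr ptD add0r Fp.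
move=> /(_ ltac:(rewrite -/N; lra)).
have -> : cjac F (pt 0 1) i zcoord * (u * a) + cjac F (pt 0 1) i wcoord * (u * b)
   = u * L by rewrite /L; ring.
set y := F _ 0 i => H.
have y1 : cabs y < 1.
  apply/F1/FBH_pt_ball; rewrite ut exprMn.
  rewrite cabs_sqrE cReD cImD cReM cImM /u /= !mul0r subr0 addr0 add0r.
  have := cabs_sqrE b; rewrite /Q in Q0 tb; nra.
have := le_trans (Re_le_cabs _) H; rewrite !(cReD, cReN) /= ler_norml => /andP[+ _].
rewrite cReM /u /= mul0r subr0.
have := le_lt_trans (Re_le_cabs y) y1; rewrite ltr_norml => /andP[_ y1'].
have : t * N <= t * (N + 1) by rewrite ler_wpM2l ?ltW//; lra.
rewrite -/N -eE; nra.
Qed.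

(** Let al and be be the two partial derivatives.  The inequality
Re (al a + be b) <= 0 at b = -1 and a = c al^* with c large excludes al != 0;
at a = 0 and b = -1 + i c with c of either sign it excludes Im be != 0. *)
Lemma normal_derivative (R : realType) (k : nat)
    (F : 'rV[Cplx R]_(1 + 1) -> 'rV[Cplx R]_k) (i : 'I_k) :
  (forall x, FBH R 1 1 x -> cabs (F x 0 i) < 1) ->
  differentiable F (pt 0 1) -> F (pt 0 1) 0 i = 1 ->
  cjac F (pt 0 1) i zcoord = 0 /\
  exists2 lambda : R, 0 <= lambda & cjac F (pt 0 1) i wcoord = lambda%:C%C.
Proof.
move=> F1 dF Fp.
have H := inward_derivative_le0 F1 dF Fp.
set al := cjac _ _ _ zcoord in H *; set be := cjac _ _ _ wcoord in H *.
have al0 : al = 0.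
  apply/eqP; rewrite -cabs_eq0 eq_le cabs_ge0 andbT leNgt; apply/negP => algt0.
  pose c := (complex.Re be + 1) / cabs al ^+ 2.
  have := H (c%:C%C * al^*) (- 1); rewrite /= oppr_lt0 ltr01 => /(_ isT).
  have -> : complex.Re (al * (c%:C%C * al^*) + be * -1) =
      c * cabs al ^+ 2 - complex.Re be.
    by rewrite cabs_sqrE; case: (al) => x y; case: (be) => x' y' /=; ring.
  rewrite /c divfK; first by lra.
  by rewrite gt_eqF// exprn_gt0.
have ReH c : - complex.Re be - c * complex.Im be <= 0.
  have := H 0 (- 1 +i* c)%C; rewrite /= oppr_lt0 ltr01 => /(_ isT).
  rewrite al0 mul0r add0r cReM /=; lra.
split=> //; exists (complex.Re be); first by have := ReH 0; lra.
apply/eqP; rewrite eq_complex /= eqxx /=; apply/negPn/negP => Imb.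
have := ReH (- (complex.Re be + 1) / complex.Im be).
by rewrite divfK//; lra.
Qed.

Lemma finite_uniform_radius (R : realType) (I : finType) (P : I -> R -> Prop) :
  (forall i, exists2 d, 0 < d & forall r, 0 < r < d -> P i r) ->
  exists2 d, 0 < d & forall r, 0 < r < d -> forall i, P i r.
Proof.
move=> H.
have /choice[d Hd] : forall i, exists d, 0 < d /\ forall r, 0 < r < d -> P i r.
  by move=> i; have [d d0 Pd] := H i; exists d.
exists (\big[Num.min/1]_i d i).
  by apply: lt_bigmin => // i _; exact: (Hd i).1.
move=> r /andP[r0 rd] i; apply: (Hd i).2; rewrite r0 (lt_le_trans rd)//.
exact: bigmin_le_cond.
Qed.

(** The disk |z| <= r at height w lies in the domain: by 1 - x <= exp(-x) it
suffices that w^2 + |z|^2 < 1, and w^2 is close to 1 - (1 + e) r^2.  The slice is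
even defined on a slightly larger disk, as the mean value property requires. *)
Lemma slice_value_le (R : realType) (k : nat)
    (F : 'rV[Cplx R]_(1 + 1) -> 'rV[Cplx R]_k) (i : 'I_k) (e r w M : R) :
  (forall x, FBH R 1 1 x -> differentiable F x) ->
  0 < e <= 1 -> 0 < r -> r ^+ 2 <= e / 4 -> w = 1 - (1 + e) / 2 * r ^+ 2 ->
  (forall z, cabs z = r -> FBH R 1 1 (pt z w%:C%C) ->
     complex.Re (F (pt z w%:C%C) 0 i) <= M) ->
  complex.Re (F (pt 0 w%:C%C) 0 i) <= M.
Proof.
move=> dF /andP[e0 e1] r0 re wE FM.
pose rho := (1 + e / 8) * r.
have rrho : r < rho by rewrite /rho; nra.
have inD z : cabs z < rho -> FBH R 1 1 (pt z w%:C%C).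
  move=> zrho; apply: FBH_pt_ball; rewrite cabs_real real_normK ?num_real//.
  have : cabs z ^+ 2 < rho ^+ 2.
    by rewrite ltr_sqr ?nnegrE ?cabs_ge0// (le_trans (cabs_ge0 z))// ltW.
  have -> : rho ^+ 2 = (1 + e / 8) ^+ 2 * r ^+ 2 by rewrite exprMn.
  rewrite wE; have : 0 < r ^+ 2 by rewrite exprn_gt0.
  move: re; set s := r ^+ 2 => se s0 zs.
  have : ((1 + e) / 2) ^+ 2 * s ^+ 2 <= 1 * (s * (e / 4)).
    apply: ler_pM; rewrite ?sqr_ge0//; first by nra.
    by rewrite expr2 ler_wpM2l// ltW.
  have : e * (e * s) <= 1 * (e * s) by rewrite ler_wpM2r// mulr_ge0// ltW.
  nra.
have dg z : cabs z < rho -> differentiable (fun z => F (pt z w%:C%C) 0 i) z.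
  by move=> /inD/dF/differentiable_slice_z.
apply: (@punctured_mean_value_le R (fun z => F (pt z w%:C%C) 0 i) r rho).
- by rewrite r0.
- by apply: differentiable_continuous; apply: dg; rewrite cabs0; lra.
- by move=> z /andP[_]; exact: dg.
- by move=> z zr; apply: FM => //; apply: inD; rewrite zr.
Qed.

Lemma sqr_perturbation (R : realType) (a x : Cplx R) (e r : R) :
  0 < e <= 1 -> 0 < r -> cabs (x - a) <= e * r ->
  cabs a ^+ 2 - 2 * cabs a * (e * r) <= cabs x ^+ 2 /\
  cabs x ^+ 2 <= (cabs a + e * r) ^+ 2.
Proof.
move=> /andP[e0 e1] r0 H.
have x0 := cabs_ge0 x; have a0 := cabs_ge0 a.
have er0 : 0 < e * r by rewrite mulr_gt0.
have h1 : cabs x <= cabs a + e * r.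
  have := cabsD (x - a) a; rewrite subrK; lra.
have h2 : cabs a <= cabs x + e * r.
  by have := cabsD (a - x) x; rewrite subrK -(cabsN (a - x)) opprB; lra.
split; last by rewrite ler_sqr// nnegrE; lra.
have [le|gt] := leP (cabs a) (e * r).
  have : cabs a * cabs a <= cabs a * (e * r) by rewrite ler_wpM2l.
  have := sqr_ge0 (cabs x); have : 0 <= cabs a * (e * r) by rewrite mulr_ge0// ltW.
  lra.
have : (cabs a - e * r) ^+ 2 <= cabs x ^+ 2.
  by rewrite ler_sqr ?nnegrE//; lra.
have := sqr_ge0 (e * r); lra.
Qed.

(** With kappa = (1 + e) / 2, all estimates hold up to errors e r in the
coordinates other than i, and e r^2 in the i-th coordinate at z = 0.  Comparing
the coefficients of r^2 gives the bound up to a multiple of e. *)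
Lemma tangential_derivative_bound (R : realType) (k : nat)
    (F : 'rV[Cplx R]_(1 + 1) -> 'rV[Cplx R]_k) (i : 'I_k) (lambda : R) :
  (forall x, FBH R 1 1 x -> differentiable F x) ->
  differentiable F (pt 0 1) ->
  (forall j, F (pt 0 1) 0 j = (j == i)%:R) ->
  (forall x, FBH R 1 1 x -> let S := \sum_(j | j != i) cabs (F x 0 j) ^+ 2 in
     cabs (F x 0 i) ^+ 2 + S <= 1 + S ^+ 2) ->
  0 <= lambda -> cjac F (pt 0 1) i wcoord = lambda%:C%C ->
  \sum_(j | j != i) cabs (cjac F (pt 0 1) j zcoord) ^+ 2 <= lambda.
Proof.
move=> dF dFp Fp Fbound la0 Fla.
pose a j := cabs (cjac F (pt 0 1) j zcoord).
have a0 j : 0 <= a j := cabs_ge0 _.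
pose c1 := \sum_(j | j != i) 2 * a j.
pose C := \sum_(j | j != i) (a j + 1) ^+ 2.
rewrite -[X in X <= _]/(\sum_(j | j != i) a j ^+ 2); set A := \sum_(j | _) _.
apply: (@le_of_linear_slack R _ _ (c1 + C ^+ 2 + lambda + 2)) => e e01.
have /andP[e0 e1] := e01.
pose w r := 1 - (1 + e) / 2 * r ^+ 2.
have expand j : exists2 d, 0 < d & forall r, 0 < r < d ->
    (j != i -> forall z, cabs z = r ->
      cabs (F (pt z (w r)%:C%C) 0 j - cjac F (pt 0 1) j zcoord * z) <= e * r) /\
    (j = i -> 1 - lambda * ((1 + e) / 2 * r ^+ 2) - e * r ^+ 2
                <= complex.Re (F (pt 0 (w r)%:C%C) 0 i)).
  have e40 : 0 < e / 4 by apply: divr_gt0.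
  have [d d0 H] := cjac_expansion j dFp e40.
  pose b := cabs (cjac F (pt 0 1) j wcoord).
  have b0 : 0 <= b := cabs_ge0 _.
  exists (Num.min (Num.min 1 (d / 2)) (e / (2 * (b + 1)))).
    rewrite !lt_min ltr01 divr_gt0//=; apply: divr_gt0 => //; lra.
  move=> r; rewrite !lt_min !ltr_pdivlMr//; last by lra.
  move=> /andP[r0 /andP[/andP[r1 rd] rb]].
  pose s := (1 + e) / 2 * r ^+ 2.
  have s0 : 0 <= s by rewrite /s mulr_ge0 ?sqr_ge0//; lra.
  have sr2 : s <= r ^+ 2 by rewrite /s -[leRHS]mul1r ler_wpM2r ?sqr_ge0//; lra.
  have r2r : r ^+ 2 <= r by rewrite expr2 ler_piMl// ltW.
  have Hz z : cabs z <= r -> cabs (F (pt z (w r)%:C%C) 0 j - (j == i)%:R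
      - (cjac F (pt 0 1) j zcoord * z + cjac F (pt 0 1) j wcoord * (- s)%:C%C))
      <= e / 4 * (cabs z + s).
    move=> zr; have := H z (- s)%:C%C.
    rewrite cabs_real normrN ger0_norm// ptD add0r Fp.
    have -> : 1 + (- s)%:C%C = (w r)%:C%C :> Cplx R.
      by apply/eqP; rewrite eq_complex /= addr0 !eqxx.
    by apply; lra.
  split.
    move=> ji z zr; have := Hz z; rewrite zr lexx (negbTE ji) subr0 => /(_ isT) {}Hz.
    set x := F _ 0 j in Hz *; set v := cjac F _ j zcoord * z in Hz *.
    set u := cjac F _ j wcoord * _ in Hz.
    have uE : cabs u <= b * r ^+ 2.
      by rewrite cabsM cabs_real normrN ger0_norm// ler_wpM2l.
    have h : cabs (x - v) <= cabs (x - (v + u)) + cabs u.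
      by rewrite [in leLHS](_ : x - v = x - (v + u) + u) ?cabsD//; ring.
    have : e / 4 * (r + s) <= e / 4 * (r + r) by rewrite ler_wpM2l ?(ltW e40)//; lra.
    have : b * r ^+ 2 <= e / 2 * r.
      have : r * (2 * b * r) <= r * e by rewrite ler_wpM2l ?(ltW r0)//; lra.
      lra.
    lra.
  move=> ji; have := Hz 0; rewrite cabs0 ji eqxx mulr0 !add0r Fla => /(_ (ltW r0)) {}Hz.
  have := le_trans (Re_le_cabs _) Hz.
  rewrite !(cReD, cReN) cReM /= ler_norml => /andP[h _].
  have : e / 4 * s <= e * r ^+ 2 by apply: ler_pM => //; lra.
  rewrite -/s; lra.
have [d d0 Hd] := finite_uniform_radius expand.
pose r := Num.min (d / 2) (e / 4).
have r0 : 0 < r by rewrite lt_min !divr_gt0.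
have rd : r < d.
  by rewrite gt_min ltr_pdivrMr// mulr_natr mulr2n ltrDl d0.
have re : r ^+ 2 <= e / 4.
  have re4 : r <= e / 4 by rewrite ge_min lexx orbT.
  by rewrite expr2; nra.
have {}Hd := Hd r; rewrite r0 rd in Hd.
have {}Hd j := Hd isT j.
have r20 : 0 < r ^+ 2 by rewrite exprn_gt0.
have C0 : 0 <= C by apply: sumr_ge0 => j _; exact: sqr_ge0.
have lower := (Hd i).2 erefl.
have upper : complex.Re (F (pt 0 (w r)%:C%C) 0 i) <=
    1 + (C ^+ 2 * r ^+ 4 - (A - e * c1) * r ^+ 2) / 2.
  apply: (@slice_value_le R k F i e r (w r)) => // z zr zD.
  have := Fbound _ zD; rewrite /=; set S := \sum_(j | _) _ => bnd.
  have pert j : j != i ->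
      (a j ^+ 2 - e * (2 * a j)) * r ^+ 2 <= cabs (F (pt z (w r)%:C%C) 0 j) ^+ 2 /\
      cabs (F (pt z (w r)%:C%C) 0 j) ^+ 2 <= (a j + 1) ^+ 2 * r ^+ 2.
    move=> /((Hd j).1)/(_ z zr)/(sqr_perturbation e01 r0).
    rewrite cabsM zr -/(a j) => -[h1 h2]; split.
      by apply: le_trans h1; rewrite !exprMn; lra.
    apply: (le_trans h2); rewrite -exprMn ler_sqr ?nnegrE.
    - by rewrite -mulrDl ler_wpM2r ?lerD2l// ltW.
    - by rewrite addr_ge0 ?mulr_ge0 ?(ltW e0) ?(ltW r0).
    - by rewrite mulr_ge0 ?addr_ge0 ?ler01 ?(ltW r0).
  have Slow : (A - e * c1) * r ^+ 2 <= S.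
    rewrite /A /c1 mulr_sumr -sumrB mulr_suml.
    by apply: ler_sum => j ji; exact: (pert j ji).1.
  have Sup : S <= C * r ^+ 2.
    by rewrite /C mulr_suml; apply: ler_sum => j ji; exact: (pert j ji).2.
  have S0 : 0 <= S by apply: sumr_ge0 => j _; exact: sqr_ge0.
  have S2 : S ^+ 2 <= C ^+ 2 * r ^+ 4.
    rewrite (_ : C ^+ 2 * r ^+ 4 = (C * r ^+ 2) ^+ 2); last by ring.
    by rewrite ler_sqr ?nnegrE// mulr_ge0// ltW.
  move: bnd; rewrite cabs_sqrE.
  have := sqr_ge0 (complex.Im (F (pt z (w r)%:C%C) 0 i)).
  have := sqr_ge0 (1 - complex.Re (F (pt z (w r)%:C%C) 0 i)).
  lra.
have C2 : C ^+ 2 * r ^+ 4 <= e * C ^+ 2 * r ^+ 2.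
  have -> : C ^+ 2 * r ^+ 4 = r ^+ 2 * (C ^+ 2 * r ^+ 2) by ring.
  rewrite -mulrA ler_wpM2r ?mulr_ge0 ?sqr_ge0//; lra.
rewrite -(ler_pM2r r20); lra.
Qed.

(** * Maps between Fock-Bargmann-Hartogs domains *)

Lemma opnorm_le (R : realType) (k l : nat) (T : set 'rV[Cplx R]_k)
    (A : 'M[Cplx R]_(l, k)) (c : R) :
  (forall a, T a -> enorm a <= 1 -> enorm (A *m a^T)^T <= c) ->
  (opnorm T A <= c%:E)%E.
Proof.
by move=> H; apply: ge_ereal_sup => _ [a [Ta a1] <-]; rewrite lee_fin H.
Qed.

Lemma ctangent11 (R : realType) (a : 'rV[Cplx R]_(1 + 1)) :
  ctangent (bpoint R 1 1) a -> a 0 wcoord = 0.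
Proof.
rewrite /ctangent /= !big_ord1 /bpoint row_mxKl row_mxKr !mxE /=.
by rewrite conjC0 mulr0 mul0r addr0 conjC1 mul1r.
Qed.

Lemma ctangent_bpoint (R : realType) (n m : nat) (hm : (0 < m)%N)
    (b : 'rV[Cplx R]_(n + m)) :
  b 0 (rshift n (Ordinal hm)) = 0 -> ctangent (bpoint R n m) b.
Proof.
move=> b0; rewrite /ctangent /= /bpoint row_mxKl row_mxKr.
rewrite (bigD1 (Ordinal hm))//= !mxE b0 mulr0 add0r.
rewrite !big1 ?addr0// => i; first by rewrite !mxE conjC0 mulr0 mul0r.
move=> iN0; rewrite !mxE (_ : (i : nat) == 0 = false) ?mulr0n ?conjC0 ?mul0r//.
by apply/negbTE; move: iN0; rewrite -val_eqE.
Qed.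

Theorem theorem1p9 (R : realType) (n m : nat) (hn : (0 < n)%N) (hm : (0 < m)%N)
    (F : 'rV[Cplx R]_(1 + 1) -> 'rV[Cplx R]_(n + m))
    (p := bpoint R 1 1) (q := bpoint R n m)
    (FD : forall x, FBH R 1 1 x -> FBH R n m (F x))
    (Fhol : forall x, FBH R 1 1 x -> holomorphic_at F x)
    (Fp_hol : holomorphic_at F p)
    (Fpq : F p = q)
    (h1_0 := rsubmx (F 0) 0 (Ordinal hm) : Cplx R) :
  exists lambda : R,
    [/\ (map_mx Num.conj (cjac F p))^T *m q^T = lambda%:C%C *: p^T,
        cabs (1 - h1_0^*) ^+ 2 / (1 - cabs h1_0 ^+ 2) <= lambda,
        0 < cabs (1 - h1_0^*) ^+ 2 / (1 - cabs h1_0 ^+ 2),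
        (forall a, ctangent p a -> ctangent (F p) (cjac F p *m a^T)^T)
      & (opnorm (ctangent p) (cjac F p) <= (Num.sqrt lambda)%:E)%E].
Proof.
pose i := rshift n (Ordinal hm).
have dF x : FBH R 1 1 x -> differentiable F x.
  by move=> /Fhol/nbhs_singleton.
have pE : p = pt 0 1 := bpoint11 R.
have dFp : differentiable F (pt 0 1) by rewrite -pE; exact: (nbhs_singleton Fp_hol).
have Fp j : F (pt 0 1) 0 j = (j == i)%:R by rewrite -pE Fpq; exact: bpoint_coord.
have F1 x : FBH R 1 1 x -> cabs (F x 0 i) < 1 by move=> /FD; exact: FBH_coord_lt1.
have Fi1 : F (pt 0 1) 0 i = 1 by rewrite Fp eqxx.
have [Jz [lambda la0 Jw]] := normal_derivative F1 dFp Fi1.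
have Jtan : \sum_j cabs (cjac F (pt 0 1) j zcoord) ^+ 2 <= lambda.
  rewrite (bigD1 i)//= Jz cabs0 expr0n add0r.
  apply: (tangential_derivative_bound dF dFp Fp _ la0 Jw).
  by move=> x /FD; exact: FBH_coord_bound.
have Ja a : ctangent p a -> forall j,
    (cjac F p *m a^T)^T 0 j = cjac F (pt 0 1) j zcoord * a 0 zcoord.
  move=> /ctangent11 aw j; rewrite mxE mxE big_split_ord !big_ord1 -pE.
  have -> : a^T wcoord 0 = 0 by rewrite mxE.
  by rewrite mulr0 /= addr0 [a^T _ _]mxE.
have h1E : h1_0 = F (pt 0 0) 0 i by rewrite pt00 /h1_0 mxE.
have h1lt1 : cabs h1_0 < 1.
  by rewrite h1E; apply/F1/FBH_pt_ball; rewrite cabs0; lra.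
exists lambda; split.
- have qT k : q^T k 0 = (k == i)%:R by rewrite mxE; exact: bpoint_coord.
  apply/colP => j; rewrite mxE (bigD1 i)//= big1 => [|k ki]; last first.
    by rewrite qT (negbTE ki) mulr0.
  rewrite qT eqxx mulr1 addr0 mxE mxE [RHS]mxE [p^T _ _]mxE pE.
  case: (split_ordP j) => j' ->; rewrite (ord1 j').
    by rewrite pt_z mulr0 Jz conjC0.
  by rewrite pt_w mulr1 Jw; apply/eqP; rewrite eq_complex /= oppr0 !eqxx.
- rewrite h1E.
  apply: (@boundary_schwarz R (fun w => F (pt 0 w) 0 i)) => //.
  + move=> w w1; apply: differentiable_slice_w; apply/dF/FBH_pt_ball.
    by rewrite cabs0 expr0n addr0 expr_lt1 ?cabs_ge0.
  + move=> w w1; apply/F1/FBH_pt_ball.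
    by rewrite cabs0 expr0n addr0 expr_lt1 ?cabs_ge0.
  + move=> e /(cjac_expansion i dFp)[d d0 H]; exists d => // t /andP[t0 td].
    have := H 0 (- t)%:C%C; rewrite cabs0 cabs_real normrN gtr0_norm// add0r.
    move=> /(_ td); rewrite ptD addr0 Fi1 Jw mulr0 add0r.
    have -> : 1 + (- t)%:C%C = (1 - t)%:C%C :> Cplx R.
      by apply/eqP; rewrite eq_complex /= addr0 !eqxx.
    rewrite (_ : (1 - lambda * t)%:C%C = 1 + lambda%:C%C * (- t)%:C%C); last first.
      by apply/eqP; rewrite eq_complex /= !mul0r !mulr0 subr0 !addr0 mulrN !eqxx.
    by rewrite opprD addrA.
- have h1N1 : 1 - h1_0^* != 0.
    rewrite subr_eq0; apply/eqP => h1.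
    by move: h1lt1; rewrite -cabsJ -h1 cabs1 ltxx.
  apply: divr_gt0; first by rewrite exprn_gt0// cabs_gt0.
  by rewrite subr_gt0 expr_lt1 ?cabs_ge0.
- move=> a ta; rewrite Fpq; apply: (@ctangent_bpoint _ _ _ hm).
  by rewrite Ja// Jz mul0r.
- apply: opnorm_le => a ta a1.
  rewrite -ler_sqr ?nnegrE ?sqrtr_ge0// enorm_sqr sqr_sqrtr//.
  under eq_bigr => j _ do rewrite Ja// cabsM exprMn.
  rewrite -mulr_suml (le_trans _ Jtan)// ler_piMr ?sumr_ge0//.
    by move=> j _; exact: sqr_ge0.
  have : enorm a ^+ 2 <= 1 by rewrite expr_le1// sqrtr_ge0.
  rewrite enorm_sqr big_split_ord !big_ord1 /=.
  by have := sqr_ge0 (cabs (a 0 wcoord)); lra.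
Qed.
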